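(* Let $G$ be a second countable compact Hausdorff topological group with normalized Haar measure, and let $\widehat{G}=\{[\pi_n]: n\in\Lambda\cup\{0\}\}$, with $\pi_0$ the trivial representation. Let $f\in L^1(G,\mathbb{C})$ satisfy $\mathrm{Re}(f)\leq 1$ a.e. on $G$ and $0\leq\widehat{f}(\pi_0)<1$. Let $\{R_n\}_{n\in\Lambda}$ be a sequence of matrices with $R_n\in\mathcal{M}_{d_{\pi_n}}(\mathbb{C})$. For each $n\in\Lambda$, let $\|\cdot\|_{\pi_n}$ be any unitarily invariant norm on $\mathcal{M}_{d_{\pi_n}}(\mathbb{C})$, let $\phi_n$ be any symmetric gauge function on $\mathbb{C}^{d_{\pi_n}^2}$, and let $M_{\chi_n}$ be a generalized matrix function on $\mathcal{M}_{d_{\pi_n}}(\mathbb{C})$, where $\chi_n$ is a character of degree $1$ on a subgroup $H_n$ of the symmetric group $S_{d_{\pi_n}}$. Then, for every interpretation of the products $\boldsymbol{\cdot}$ (see context) and for all $x\in G$: (i) If $\sum_{n\in\Lambda}\|R_n\|_{\pi_n}\leq 1/2$, then $$\widehat{f}(\pi_0)+\sum_{n\in\Lambda}\left\|\left(\widehat{f}(\pi_n)+\overline{\widehat{f}(\overline{\pi_n})}\right)\boldsymbol{\cdot}\pi_n(x)\boldsymbol{\cdot}R_n\right\|_{\pi_n}\leq 1.$$ (ii) If $\sum_{n\in\Lambda}d_{\pi_n}^2\phi_n(R_n)\leq 1/2$, then $$\widehat{f}(\pi_0)+\sum_{n\in\Lambda}\phi_n\left(\left(\widehat{f}(\pi_n)+\overline{\widehat{f}(\overline{\pi_n})}\right)\boldsymbol{\cdot}\pi_n(x)\boldsymbol{\cdot}R_n\right)\leq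 1.$$ (iii) If $\sum_{n\in\Lambda}\dfrac{\|R_n\|_{\pi_n}}{\|E_{11}^{(n)}\|_{\pi_n}}\leq 1/2$, then $$\widehat{f}(\pi_0)+\sum_{n\in\Lambda}\left|M_{\chi_n}\left(\left(\widehat{f}(\pi_n)+\overline{\widehat{f}(\overline{\pi_n})}\right)\boldsymbol{\cdot}\pi_n(x)\boldsymbol{\cdot}R_n\right)\right|^{\frac{1}{d_{\pi_n}}}\leq 1.$$ Moreover, if instead $\widehat{f}(\pi_0)=1$ (with $f\in L^1(G,\mathbb{C})$ and $\mathrm{Re}(f)\leq 1$ a.e. on $G$ as before), then equality holds in each of the three displayed inequalities in (i), (ii) and (iii) for any sequence $\{R_n\}_{n\in\Lambda}$ with $R_n\in\mathcal{M}_{d_{\pi_n}}(\mathbb{C})$, i.e. the $R_n$ need not satisfy any of the summability conditions.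
   Context: **Group and representations.** $G$ is a second countable, compact, Hausdorff topological group, not necessarily abelian, with bi-invariant Haar measure $m$ normalized by $m(G)=1$; $dx$ denotes integration with respect to $m$. $\widehat{G}$ is the set of unitary equivalence classes of irreducible unitary (strongly continuous) representations of $G$. It is countable and written $\widehat{G}=\{[\pi_n]:n\in\Lambda\cup\{0\}\}$ (distinct indices for distinct classes), where $\Lambda$ is either $\mathbb{N}=\{1,2,\dots\}$ or a finite set $\{1,\dots,n_0\}$, $\pi_n$ is a chosen representative of its class acting on the Hilbert space $\mathcal{H}_{\pi_n}$, and $d_{\pi_n}=\dim\mathcal{H}_{\pi_n}<\infty$. $\pi_0$ is the trivial representation $\pi_0(x)=1$ on $\mathbb{C}$. Fixing an orthonormal basis $\{e_j\}$ of $\mathcal{H}_{\pi_n}$, $\pi_n(x)$ is identified with the unitary matrix with entries $\pi_n(x)_{ij}=\langle\pi_n(x)e_j,e_i\rangle$. The contragredient $\overline{\pi_n}$ has matrix entries $\overline{\pi_n(x)_{ij}}$. **Fourier transform.** For $f\in L^1(G,\mathbb{C})$, $\widehat{f}(\pi_n)=\int_G f(x)\pi_n(x)^*\,dx$, regarded as the matrix with entries $\widehat{f}(\pi_n)_{ij}=\int_G f(x)\overline{\pi_n(x)_{ji}}\,dx$. Likewise $\widehat{f}(\overline{\pi_n})$ has entries $\int_G f(x)\pi_n(x)_{ji}\,dx$. In particular $\widehat{f}(\pi_0)=\int_G f\,dx$. For a complex matrix $A$, $\overline{A}$ is its entrywise complex conjugate. **Matrices.** $\mathcal{M}_d(\mathbb{C})$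 is the space of $d\times d$ complex matrices. $E_{11}^{(n)}\in\mathcal{M}_{d_{\pi_n}}(\mathbb{C})$ has $(1,1)$ entry $1$ and all other entries $0$. $A\circ B$ is the Hadamard (entrywise) product. The symbol $A\boldsymbol{\cdot}B$ denotes either the usual product $AB$ or the Hadamard product $A\circ B$, and $A\boldsymbol{\cdot}B\boldsymbol{\cdot}C$ may be any one of the six matrices $A\circ B\circ C$, $ABC$, $A\circ(BC)$, $A(B\circ C)$, $(A\circ B)C$, $(AB)\circ C$; the results hold for each of these choices. **Norms and functions on matrices.** A norm $\|\cdot\|$ on $\mathcal{M}_d(\mathbb{C})$ is unitarily invariant if $\|UAV\|=\|A\|$ for all unitary $U,V$ and all $A$. A symmetric gauge function on $\mathbb{C}^N$ is a norm $\phi:\mathbb{C}^N\to[0,\infty)$ with $\phi(x_1,\dots,x_N)=\phi(|x_1|,\dots,|x_N|)$ and invariant under permutations of coordinates; for $A\in\mathcal{M}_d(\mathbb{C})$ and $\phi$ on $\mathbb{C}^{d^2}$, $\phi(A)$ is $\phi$ applied to the $d^2$ entries of $A$ listed in any order. For a subgroup $H\leq S_d$ and a character $\chi$ of degree $1$ on $H$ (a nontrivial, i.e. not identically zero, multiplicative homomorphism of $H$ into the complex numbers), the generalized matrix function is $M_\chi(A)=\sum_{\sigma\in H}\chi(\sigma)\prod_{i=1}^d A_{i\sigma(i)}$, $A\in\mathcal{M}_d(\mathbb{C})$. *)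

(* Defs.v *)
From HB Require Import structures.
From mathcomp Require Import all_boot all_order all_fingroup all_algebra.
From mathcomp Require Import spectral.
From mathcomp Require Import all_classical all_reals all_analysis.
From mathcomp Require Import complex.
Set Implicit Arguments.
Unset Strict Implicit.
Unset Printing Implicit Defensive.
Import Order.TTheory GRing.Theory Num.Theory.
Import numFieldNormedType.Exports.
Import ComplexField.Normc.
Local Open Scope classical_set_scope.
Local Open Scope ring_scope.
Local Open Scope sesquilinear_scope.

(* The distinguished point of PointedTopological is arbitrary; it is required
   only because measurable types are pointed. *)
HB.mixin Record isTopologicalGroup G of monoid.Group G & PointedTopological G := {
  mulg_continuous : continuous (fun p : G * G => (p.1 * p.2)%g) ;
  invg_continuous : continuous (fun x : G => x^-1%g)
}.

#[short(type="topologicalGroupType")]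
HB.structure Definition TopologicalGroup :=
  {G of monoid.Group G & PointedTopological G & isTopologicalGroup G}.

Notation borel G := (g_sigma_algebraType (@open G)).

Section Haar.
Context (R : realType) (G : topologicalGroupType).

(* Total mass 1 is part of [probability]; on a second countable compact
   Hausdorff group regularity of a finite Borel measure is automatic. *)
Definition haar_probability (mu : probability (borel G) R) :=
  forall (g : G) (A : set (borel G)), measurable A ->
    mu [set (g * y)%g | y in A] = mu A /\ mu [set (y * g)%g | y in A] = mu A.

End Haar.

Section ComplexIntegral.
Context d (T : measurableType d) (R : realType).
Variable mu : {measure set T -> \bar R}.

Definition L1 (f : T -> R[i]) :=
  [/\ measurable_fun setT (fun x => complex.Re (f x)),
      measurable_fun setT (fun x => complex.Im (f x)) &
      (\int[mu]_x (normc (f x))%:E < +oo)%E].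

Definition Cintegral (f : T -> R[i]) : R[i] :=
  Complex (\int[mu]_x complex.Re (f x)) (\int[mu]_x complex.Im (f x)).

End ComplexIntegral.

Section Representations.
Context (R : realType) (G : topologicalGroupType).

(* In finite dimension a unitary representation is a matrix representation in
   an orthonormal basis, acting on column vectors. *)
Record unitary_rep (d : nat) (p : G -> 'M[R[i]]_d) : Prop := {
  rep_unitary : forall x, p x \is unitarymx ;
  rep_mul : forall x y, p (x * y)%g = p x *m p y ;
  rep_continuous : forall v : 'cV[R[i]]_d, continuous (fun x => p x *m v : 'cV[R[i]^o]_d)
}.

Definition irreducible_rep (d : nat) (p : G -> 'M[R[i]]_d) :=
  (0 < d)%N /\
  forall W : {vspace 'cV[R[i]]_d},
    (forall x v, v \in W -> p x *m v \in W) -> W = 0%VS \/ W = fullv.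

Definition unitarily_equivalent (d e : nat)
    (p : G -> 'M[R[i]]_d) (q : G -> 'M[R[i]]_e) :=
  exists U : 'M[R[i]]_(d, e),
    [/\ U *m U ^t* = 1%:M, U ^t* *m U = 1%:M &
        forall x, U *m q x = p x *m U].

(* [p n], for n in {0} U L, is a system of representatives of the unitary dual
   of G. Irreducible unitary representations of a compact group being finite
   dimensional, exhaustivity only quantifies over matrix representations.
   The values of [d] and [p] outside {0} U L are irrelevant. *)
Record unitary_dual (L : set nat) (d : nat -> nat)
    (p : forall n, G -> 'M[R[i]]_(d n)) : Prop := {
  dual_index : L = [set n | (1 <= n)%N] \/
    exists n0, L = [set n | (1 <= n <= n0)%N] ;
  dual_trivial : d 0%N = 1%N /\ forall x, p 0%N x = 1%:M ;
  dual_irreducible : forall n, (0%N |` L) n ->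
    unitary_rep (p n) /\ irreducible_rep (p n) ;
  dual_distinct : forall m n, (0%N |` L) m -> (0%N |` L) n ->
    unitarily_equivalent (p m) (p n) -> m = n ;
  dual_exhaustive : forall e (q : G -> 'M[R[i]]_e),
    unitary_rep q -> irreducible_rep q ->
    exists2 n, (0%N |` L) n & unitarily_equivalent q (p n)
}.

Definition contragredient (d : nat) (p : G -> 'M[R[i]]_d) (x : G) :
  'M[R[i]]_d := map_mx Num.conj (p x).

Definition fourier (mu : probability (borel G) R) (f : borel G -> R[i])
    (d : nat) (p : G -> 'M[R[i]]_d) : 'M[R[i]]_d :=
  \matrix_(i, j) Cintegral mu (fun x => f x * ((p x) ^t*) i j).

Lemma fourier_trivial (mu : probability (borel G) R) (f : borel G -> R[i]) :
  fourier mu f (fun _ : G => 1%:M : 'M[R[i]]_1) = (Cintegral mu f)%:M.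
Proof.
apply/matrixP => i j; rewrite !mxE !ord1 eqxx mulr1n; congr Cintegral.
by apply/funext => x; rewrite conjC1 mulr1.
Qed.

End Representations.

Section Matrices.
Context (R : realType).
Local Notation C := R[i].

Definition hadamard m n (A B : 'M[C]_(m, n)) : 'M[C]_(m, n) :=
  map2_mx *%R A B.

Variant triple_product :=
  | HadHad      (* A o B o C *)
  | MulMul      (* A B C *)
  | HadMulR     (* A o (B C) *)
  | MulHadR     (* A (B o C) *)
  | HadMulL     (* (A o B) C *)
  | MulHadL.    (* (A B) o C *)

Definition dot3 (o : triple_product) d (A B D : 'M[C]_d) : 'M[C]_d :=
  match o with
  | HadHad => hadamard (hadamard A B) D
  | MulMul => A *m B *m D
  | HadMulR => hadamard A (B *m D)
  | MulHadR => A *m hadamard B D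
  | HadMulL => hadamard A B *m D
  | MulHadL => hadamard (A *m B) D
  end.

(* The general entry makes sense for every d, so no proof of 0 < d is needed. *)
Definition E11 d : 'M[C]_d :=
  \matrix_(i, j) ((i == 0%N :> nat) && (j == 0%N :> nat))%:R.

Record is_norm (V : lmodType C) (N : V -> R) : Prop := {
  is_norm_ge0 : forall v, 0 <= N v ;
  is_norm_eq0 : forall v, N v = 0 -> v = 0 ;
  is_normZ : forall a v, N (a *: v) = normc a * N v ;
  is_norm_triangle : forall v w, N (v + w) <= N v + N w
}.

Definition unitarily_invariant_norm d (N : 'M[C]_d -> R) :=
  is_norm N /\
  forall U V A : 'M[C]_d, U \is unitarymx -> V \is unitarymx ->
    N (U *m A *m V) = N A.

Definition symmetric_gauge k (phi : 'rV[C]_k -> R) :=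
  [/\ is_norm phi,
      forall v, phi v = phi (map_mx (fun z => `|z|) v) &
      forall (s : 'S_k) v, phi (col_perm s v) = phi v].

Definition degree1_character d (H : {group 'S_d}) (chi : 'S_d -> C) :=
  {in H &, forall s t, chi (s * t)%g = chi s * chi t} /\
  exists2 s, s \in H & chi s != 0.

Definition gen_matrix_fun d (H : {group 'S_d}) (chi : 'S_d -> C)
    (A : 'M[C]_d) : C :=
  \sum_(s in H) chi s * \prod_i A i (s i).

End Matrices.

(* Main.v *)
Require Import Defs.
From HB Require Import structures.
From mathcomp Require Import all_boot all_order all_fingroup all_algebra.
From mathcomp Require Import spectral.
From mathcomp Require Import all_classical all_reals all_analysis.
From mathcomp Require Import measurable_realfun.
From mathcomp Require Import complex.
From mathcomp Require Import ring lra.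
Set Implicit Arguments.
Unset Strict Implicit.
Unset Printing Implicit Defensive.
Import Order.TTheory GRing.Theory Num.Theory.
Import numFieldNormedType.Exports.
Import ComplexField.Normc.
Local Open Scope classical_set_scope.
Local Open Scope ring_scope.
Local Open Scope sesquilinear_scope.

(** Write [u] for the real part of [f]. The matrix
    [fourier f pi_n + conj (fourier f (conj pi_n))] is the Fourier coefficient of
    [2 u] at [pi_n]. For [n] in [L] the representation [pi_n] is irreducible and
    not trivial, so its Haar mean vanishes ([mean_mx_eq0]) and the matrix equals
    [- 2 int (1 - u) pi_n^H]. Since [1 - u >= 0], this is an average of unitary
    matrices with total weight [c = 2 (1 - f0)], and its operator norm is at most
    [c] ([opbound_fourier_sym]).

    It remains to see that multiplying [pi_n(x)] and [R_n] by a matrix [B] of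
    operator norm at most [c], in any of the six ways, costs at most a factor
    [c]:
    - for a unitarily invariant norm, [|| B M || <= c || M ||] because the
      singular values of [B] make [B] an average of [c] times unitary matrices,
      and [|| B o M || <= c || M ||] because the singular values of [B o M] are
      dominated by [c] times a mean of images of those of [M] under products of
      orthostochastic matrices ([uinorm_opbound_hadamard], [uinorm_dot3]);
    - a symmetric gauge function is monotone in the moduli of the entries, and
      the entries of [B] are bounded by [c]; a usual product by [B] is a sum of
      [d^2] rearrangements ([gauge_dot3]);
    - the generalized matrix function is, up to the factor [|H|], the value of
      the sesquilinear form of the [d]-th tensor power at the vector of
      coefficients [chi], whence [|M_chi(A)| <= ||A||^d] for the operator norm
      ([gen_matrix_fun_le]), while the operator norm is at most
      [N(A) / N(E11)] for any unitarily invariant norm [N] ([uinorm_opbound]).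

    Summing over [n] gives at most [f0 + 2 (1 - f0) / 2 = 1] in all three cases.
    If [f0 = 1] then [c = 0] and all terms vanish. *)

(** * Real and imaginary parts *)

Section ComplexParts.
Context (R : realType).
Local Notation C := R[i].
Local Notation Re := (@complex.Re R).
Local Notation Im := (@complex.Im R).

Lemma ReD (x y : C) : Re (x + y) = Re x + Re y.
Proof. by case: x => a b; case: y. Qed.

Lemma ReN (x : C) : Re (- x) = - Re x.
Proof. by case: x. Qed.

Lemma Re_sum I (r : seq I) (P : pred I) (F : I -> C) :
  Re (\sum_(i <- r | P i) F i) = \sum_(i <- r | P i) Re (F i).
Proof. exact: (big_morph Re ReD). Qed.

Lemma Re_conj (x : C) : Re (x^*) = Re x.
Proof. by case: x. Qed.

Lemma Im_conj (x : C) : Im (x^*) = - Im x.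
Proof. by case: x. Qed.

Lemma ReM (x y : C) : Re (x * y) = Re x * Re y - Im x * Im y.
Proof. by case: x => a b; case: y. Qed.

Lemma ImM (x y : C) : Im (x * y) = Re x * Im y + Im x * Re y.
Proof. by case: x => a b; case: y. Qed.

Lemma normc2 (x : C) : normc x ^+ 2 = Re x ^+ 2 + Im x ^+ 2.
Proof. by case: x => a b /=; rewrite sqr_sqrtr // addr_ge0 ?sqr_ge0. Qed.

Lemma normcC (x : C) : (normc x)%:C%C = `|x|.
Proof. by case: x. Qed.

Lemma normc_ge0 (x : C) : 0 <= normc x.
Proof. by case: x => a b; exact: sqrtr_ge0. Qed.

Lemma conjMnormc (x : C) : x^* * x = (normc x ^+ 2)%:C%C.
Proof. by rewrite mulrC -normCK rmorphXn /= normcC. Qed.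

Lemma normc_conj (x : C) : normc (x^*) = normc x.
Proof. by case: x => a b /=; rewrite sqrrN. Qed.

Lemma normc_real (x : R) : 0 <= x -> normc x%:C%C = x.
Proof. by move=> x0 /=; rewrite expr0n addr0 sqrtr_sqr ger0_norm. Qed.

Lemma Im_sum I (r : seq I) (P : pred I) (F : I -> C) :
  Im (\sum_(i <- r | P i) F i) = \sum_(i <- r | P i) Im (F i).
Proof. by apply: (big_morph Im) => // -[a b] [a' b']. Qed.

Lemma normRe_le (z : C) : `|Re z| <= normc z.
Proof.
rewrite -sqrtr_sqr -[normc _]ger0_norm ?normc_ge0 // -sqrtr_sqr.
by rewrite ler_wsqrtr // normc2 lerDl sqr_ge0.
Qed.

Lemma normIm_le (z : C) : `|Im z| <= normc z.
Proof.
rewrite -sqrtr_sqr -[normc _]ger0_norm ?normc_ge0 // -sqrtr_sqr.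
by rewrite ler_wsqrtr // normc2 lerDr sqr_ge0.
Qed.

Lemma Re_conjM_le (x y : C) :
  Re (x^* * y) <= (normc x ^+ 2 + normc y ^+ 2) / 2.
Proof.
rewrite ReM Re_conj Im_conj !normc2.
have := sqr_ge0 (Re x - Re y); have := sqr_ge0 (Im x - Im y).
by rewrite !sqrrB; lra.
Qed.

Lemma conj_rC (x : R) : (x%:C%C : C)^* = x%:C%C.
Proof. exact: conjc_real. Qed.
End ComplexParts.

(** * Operator norm bounds *)

Section OpBound.
Context (R : realType).
Local Notation C := R[i].
Local Notation Re := (@complex.Re R).

Definition sqn n (v : 'cV[C]_n) : R := \sum_i normc (v i 0) ^+ 2.

(** The operator norm of [A] is at most [c]. For one pair [w], [v] this
    is weaker than the bound by [c |w| |v|], which follows by rescaling [w] and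
    [v]; the arithmetic mean avoids square roots and stays additive when
    sums of squares are split over several vectors. *)
Definition opbound n (c : R) (A : 'M[C]_n) := forall w v : 'cV[C]_n,
  Re ((w^t* *m A *m v) 0 0) <= c * ((sqn w + sqn v) / 2).

Lemma sqnE n (v : 'cV[C]_n) : (v^t* *m v) 0 0 = (sqn v)%:C%C.
Proof.
rewrite mxE rmorph_sum; apply: eq_bigr => i _ /=.
by rewrite !mxE conjMnormc.
Qed.

Lemma unitary_adj_mul n (U : 'M[C]_n) : U \is unitarymx -> U^t* *m U = 1%:M.
Proof. by move=> /unitarymxP /mulmx1C. Qed.

Lemma unitary_adj n (U : 'M[C]_n) : U \is unitarymx -> U^t* \is unitarymx.
Proof. by rewrite trmxC_unitary. Qed.

Lemma sqn_unitary n (U : 'M[C]_n) v : U \is unitarymx -> sqn (U *m v) = sqn v.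
Proof.
move=> Uu; apply: (@complexI R); rewrite -!sqnE trmx_mul map_mxM /=.
by rewrite mulmxA -[_ *m _ *m U]mulmxA unitary_adj_mul ?mulmx1 //.
Qed.

Lemma Re_dot_le n (w v : 'cV[C]_n) :
  Re ((w^t* *m v) 0 0) <= (sqn w + sqn v) / 2.
Proof.
rewrite mxE Re_sum /sqn -big_split /= mulr_suml; apply: ler_sum => i _.
by rewrite !mxE Re_conjM_le.
Qed.

Lemma opbound_unitary n (U : 'M[C]_n) : U \is unitarymx -> opbound 1 U.
Proof.
move=> Uu w v; rewrite -mulmxA mul1r -(sqn_unitary v Uu); exact: Re_dot_le.
Qed.

Lemma opbound_mulr n c (A U : 'M[C]_n) : opbound c A -> U \is unitarymx ->
  opbound c (A *m U).
Proof.
by move=> Ac Uu w v; rewrite mulmxA -mulmxA -(sqn_unitary v Uu); exact: Ac.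
Qed.

Lemma opbound_mull n c (U A : 'M[C]_n) : U \is unitarymx -> opbound c A ->
  opbound c (U *m A).
Proof.
move=> Uu Ac w v; have Uu' : U^t* \is unitarymx by rewrite trmxC_unitary.
rewrite -(sqn_unitary w Uu').
by have := Ac (U^t* *m w) v; rewrite trmx_mul map_mxM trmxCK /= !mulmxA.
Qed.

Lemma sesqform_sum n (w v : 'cV[C]_n) (A : 'M[C]_n) :
  (w^t* *m A *m v) 0 0 = \sum_i \sum_j (w i 0)^* * A i j * v j 0.
Proof.
rewrite mxE exchange_big /=; apply: eq_bigr => j _.
by rewrite mxE mulr_suml; apply: eq_bigr => i _; rewrite !mxE.
Qed.

Lemma sum_delta n (F : 'I_n -> R) l : \sum_i (if i == l then F i else 0) = F l.
Proof. by rewrite -big_mkcond big_pred1_eq. Qed.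

Lemma unitary_row n (U : 'M[C]_n) i :
  U \is unitarymx -> \sum_j normc (U i j) ^+ 2 = 1.
Proof.
move=> /unitarymxP /matrixP /(_ i i); rewrite !mxE eqxx => h.
apply: (@complexI R); rewrite rmorph_sum rmorph1 -[RHS]h.
by apply: eq_bigr => j _; rewrite !mxE mulrC conjMnormc.
Qed.

(** Writing the entries of [A o U] as
    [A i j * U i j = sum_l A i j * (U i l) * (j == l)], its sesquilinear form is
    the sum over [l] of the form of [A] at a rescaling of [w] by the column [l]
    of [U] and at the coordinate [l] of [v]. The squared norms of these vectors
    add up to those of [w] and [v] since the rows of [U] are unit vectors. *)
Lemma opbound_hadamard n c (A U : 'M[C]_n) : 0 <= c -> opbound c A ->
  U \is unitarymx -> opbound c (hadamard A U).
Proof.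
move=> c0 Ac Uu w v.
pose wl l : 'cV[C]_n := \col_i ((U i l)^* * w i 0).
pose vl l : 'cV[C]_n := \col_j (if j == l then v j 0 else 0).
have -> : ((w^t* *m hadamard A U *m v) 0 0) =
    \sum_l ((wl l)^t* *m A *m vl l) 0 0.
  under eq_bigr do rewrite sesqform_sum.
  rewrite sesqform_sum [RHS]exchange_big /=; apply: eq_bigr => i _.
  rewrite [RHS]exchange_big /=; apply: eq_bigr => j _.
  rewrite (bigD1 j) //= !mxE eqxx big1 ?addr0; last first.
    by move=> l; rewrite !mxE eq_sym => /negPf ->; rewrite mulr0.
  by rewrite rmorphM /= conjCK; ring.
rewrite Re_sum (le_trans (ler_sum _ (fun l _ => Ac (wl l) (vl l)))) //.
rewrite -mulr_sumr -mulr_suml big_split /=.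
have -> : \sum_l sqn (wl l) = sqn w.
  rewrite exchange_big /=; apply: eq_bigr => i _.
  transitivity (\sum_l normc (U i l) ^+ 2 * normc (w i 0) ^+ 2).
    by apply: eq_bigr => l _; rewrite mxE normcM normc_conj exprMn.
  by rewrite -mulr_suml unitary_row // mul1r.
have -> // : \sum_l sqn (vl l) = sqn v.
rewrite exchange_big /=; apply: eq_bigr => j _.
rewrite -(sum_delta (fun=> normc (v j 0) ^+ 2) j); apply: eq_bigr => l _.
by rewrite mxE eq_sym; case: eqP => // _; rewrite normc0 expr0n.
Qed.

Lemma normc_phase (z : C) : exists2 u : C, normc u <= 1 & u^* * z = (normc z)%:C%C.
Proof.
have [->|z0] := eqVneq z 0; first by exists 0; rewrite ?normc0 ?mulr0.
exists (z / (normc z)%:C%C).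
  rewrite normcM normcV normc_real ?normc_ge0 // divff //.
  by apply: contra_neq z0 => /eq0_normc.
rewrite rmorphM /= mulrAC conjMnormc fmorphV /= normcC conj_Creal ?normr_real //.
rewrite -normcC rmorphXn /= expr2 mulfK //.
by rewrite normcC normr_eq0.
Qed.

(** The definition of [opbound] controls a real part only; rotating [w] by
    the phase of the value turns that real part into the modulus. *)
Lemma opbound_norm n c (A : 'M[C]_n) w v : 0 <= c -> opbound c A ->
  normc ((w^t* *m A *m v) 0 0) <= c * ((sqn w + sqn v) / 2).
Proof.
move=> c0 Ac; set z := _ 0 0; have [u u1 uz] := normc_phase z.
have -> : normc z = Re (((u *: w)^t* *m A *m v) 0 0).
  transitivity (Re (u^* * z)); first by rewrite uz.
  rewrite /z !sesqform_sum mulr_sumr; congr Re; apply: eq_bigr => i _.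
  by rewrite mulr_sumr; apply: eq_bigr => j _; rewrite !mxE rmorphM /= !mulrA.
apply: le_trans (Ac _ _) _; rewrite ler_wpM2l // ler_pM2r ?invr_gt0 //.
rewrite lerD2r; apply: ler_sum => i _; rewrite mxE normcM exprMn.
by rewrite ler_piMl ?exprn_ge0 ?normc_ge0 // expr_le1 ?normc_ge0.
Qed.

Lemma sqn_delta n (i : 'I_n) : sqn (delta_mx i 0) = 1.
Proof.
rewrite /sqn (bigD1 i) //= big1 ?addr0; last first.
  move=> j /negPf ji; by rewrite mxE ji normc0 expr0n.
by rewrite mxE !eqxx normc1 expr1n.
Qed.

Lemma opbound_entry n c (A : 'M[C]_n) i j : 0 <= c -> opbound c A ->
  normc (A i j) <= c.
Proof.
move=> c0 Ac; have := opbound_norm (delta_mx i 0) (delta_mx j 0) c0 Ac.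
rewrite !sqn_delta; have -> : (1 + 1) / 2 = 1 :> R by lra.
rewrite mulr1 trmx_delta map_delta_mx.
by rewrite -rowE -colE !mxE.
Qed.
End OpBound.

(** * Singular value decomposition *)

Section SVD.
Context (R : realType).
Local Notation C := R[i].

Definition rdiag n (s : 'I_n -> R) : 'M[C]_n := diag_mx (\row_i (s i)%:C%C).

Lemma rdiag_mulE n (s : 'I_n -> R) (A : 'M[C]_n) i j :
  (rdiag s *m A) i j = (s i)%:C%C * A i j.
Proof. by rewrite mul_diag_mx !mxE. Qed.

(** A zero row is replaced by a nonzero vector orthogonal to all rows, which
    exists because the matrix is singular, and its scaling factor is set to 0.
    Once no row vanishes it only remains to normalise them. *)
Lemma orthogonal_rows_factor n (Y : 'M[C]_n) :
  (forall a b, a != b -> \sum_l Y a l * (Y b l)^* = 0) ->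
  exists s : 'I_n -> R, exists2 Q : 'M[C]_n, Q \is unitarymx &
    (forall i, 0 <= s i) /\ Y = rdiag s *m Q.
Proof.
have [k] := ubnP #|[set i | row i Y == 0]%SET|.
elim: k Y => // k IHk Y; rewrite ltnS => sY Yo.
have [Y0|[i iY]] := set_0Vmem [set i | row i Y == 0]%SET.
  pose s i := Num.sqrt (\sum_l normc (Y i l) ^+ 2).
  have s2 i : (s i)%:C%C ^+ 2 = \sum_l Y i l * (Y i l)^*.
    rewrite -rmorphXn /= sqr_sqrtr ?sumr_ge0 // => [|l _]; last by rewrite sqr_ge0.
    by rewrite rmorph_sum; apply: eq_bigr => l _; rewrite mulrC conjMnormc.
  have s0 i : (s i)%:C%C != 0 :> C.
    apply/eqP => si0; have : i \in [set i | row i Y == 0]%SET; last by rewrite Y0 inE.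
    rewrite inE; apply/eqP/rowP => l; rewrite !mxE; apply/eqP.
    have /eqP := s2 i; rewrite si0 expr0n eq_sym psumr_eq0; last first.
      by move=> ? _; exact: mul_conjC_ge0.
    by move=> /allP /(_ l (mem_index_enum _)); rewrite mul_conjC_eq0.
  exists s; exists (\matrix_(i, j) ((s i)%:C%C^-1 * Y i j)).
    apply/unitarymxP/matrixP => a b; rewrite !mxE.
    under eq_bigr do rewrite !mxE rmorphM fmorphV /= conj_rC mulrACA.
    rewrite -mulr_sumr; have [<-|ab] := eqVneq a b; last by rewrite Yo ?mulr0.
    by rewrite -s2 -invfM -expr2 ?eqxx mulVf // expf_neq0.
  split=> [i|]; first exact: sqrtr_ge0.
  by apply/matrixP => i j; rewrite rdiag_mulE !mxE mulVKf.
move: iY; rewrite inE => /eqP Yi.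
(* the rows of Y cannot span the whole space since row i is zero *)
have [u uK u0] : exists2 u : 'rV[C]_n, (u <= kermx (Y^t*))%MS & u != 0.
  apply/rowV0Pn; rewrite kermx_eq0 row_free_unit; apply/negP => Yu.
  have /mulmxV YV : Y^t* \in unitmx by [].
  have : delta_mx 0 i *m Y = 0 :> 'rV[C]_n by rewrite -rowE.
  move=> /(congr1 (fun X => X^t*)); rewrite trmx_mul map_mxM trmx0 map_mx0 /=.
  move/(congr1 (mulmx (invmx (Y^t*)))); rewrite mulmx0 mulKmx //.
  rewrite trmx_delta map_delta_mx => /matrixP/(_ i 0); rewrite !mxE !eqxx /=.
  by move/eqP; rewrite oner_eq0.
move/sub_kermxP : uK => uK.
have uY b : \sum_l u 0 l * (Y b l)^* = 0.
  transitivity ((u *m Y^t*) 0 b); last by rewrite uK mxE.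
  by rewrite mxE; apply: eq_bigr => l _; rewrite !mxE.
pose Y' := \matrix_(a, b) (if a == i then u 0 b else Y a b).
have [] := IHk Y'.
- apply: leq_trans sY; apply: proper_card; apply/properP; split.
    apply/fintype.subsetP => a; rewrite !inE => /eqP/rowP Y'a; apply/eqP/rowP => b.
    have := Y'a b; rewrite !mxE; case: eqP => [->|//].
    by move/rowP: Yi => /(_ b); rewrite !mxE.
  exists i; first by rewrite inE Yi.
  rewrite inE; apply: contra u0 => /eqP/rowP Y'i; apply/eqP/rowP => b.
  by have := Y'i b; rewrite !mxE eqxx.
- move=> a b ab; under eq_bigr do rewrite !mxE.
  have [ai|ai] := eqVneq a i; have [bi|bi] := eqVneq b i.
  + by rewrite ai bi eqxx in ab.
  + exact: uY.
  + transitivity ((\sum_l u 0 l * (Y a l)^*)^*); last by rewrite uY conjC0.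
    rewrite rmorph_sum; apply: eq_bigr => l _; by rewrite rmorphM /= conjCK mulrC.
  + exact: Yo.
move=> s [Q Qu [s0 Y'E]].
exists (fun a => if a == i then 0 else s a); exists Q => //; split.
  by move=> a; case: ifP.
apply/matrixP => a b; rewrite rdiag_mulE.
have [->|ai] := eqVneq a i.
  by rewrite mul0r; move/rowP : Yi => /(_ b); rewrite !mxE.
by rewrite -rdiag_mulE -Y'E mxE (negPf ai).
Qed.

(** A unitary matrix that diagonalizes [A A^H] multiplies [A] into a matrix
    with orthogonal rows. *)
Lemma svd n (A : 'M[C]_n) : exists U V : 'M[C]_n, exists s : 'I_n -> R,
  [/\ U \is unitarymx, V \is unitarymx, forall i, 0 <= s i
    & A = U *m rdiag s *m V].
Proof.
have /orthomx_spectralP : A *m A^t* \is normalmx.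
  by apply/normalmxP; rewrite trmx_mul map_mxM trmxCK.
set P := spectralmx _ => AE.
have Pu : P \is unitarymx by exact: spectral_unitarymx.
have [|s [Q Qu [s0 PA]]] := @orthogonal_rows_factor n (P *m A).
  move=> a b ab; transitivity (((P *m A) *m (P *m A)^t*) a b).
    by rewrite mxE; apply: eq_bigr => l _; rewrite !mxE.
  rewrite trmx_mul map_mxM /= -mulmxA [A *m _]mulmxA AE !mulmxA.
  rewrite mulmxV ?spectral_unit // mul1mx mulmxtVK //.
  by rewrite mxE (negPf ab).
exists (P^t*), Q, s; split; [exact: unitary_adj|exact: Qu|exact: s0|].
by rewrite -mulmxA -PA mulmxA (mulmx1C (unitarymxP Pu)) mul1mx.
Qed.
End SVD.

(** * Norms and averaging *)

Section Norms.
Context (R : realType).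
Local Notation C := R[i].
Variables (V : lmodType C) (N : V -> R).
Hypothesis Nn : is_norm N.

Lemma norm0 : N 0 = 0.
Proof. by rewrite -(scale0r (0 : V)) (is_normZ Nn) normc0 mul0r. Qed.

Lemma norm_scale_ge0 (t : R) v : 0 <= t -> N (t%:C%C *: v) = t * N v.
Proof. by move=> t0; rewrite (is_normZ Nn) normc_real. Qed.

Lemma norm_sum I (r : seq I) (P : pred I) (F : I -> V) :
  N (\sum_(i <- r | P i) F i) <= \sum_(i <- r | P i) N (F i).
Proof.
elim/big_rec2 : _ => [|i x y _ le]; first by rewrite norm0.
by apply: le_trans (is_norm_triangle Nn _ _) _; rewrite lerD2l.
Qed.

Lemma norm_midpoint v w t : N v <= t -> N w <= t ->
  N (2^-1%:C%C *: (v + w)) <= t.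
Proof.
move=> vt wt; rewrite norm_scale_ge0 ?invr_ge0 //.
have := is_norm_triangle Nn v w; lra.
Qed.
End Norms.

Section Phase.
Context (R : realType).
Local Notation C := R[i].

(** A unimodular number with prescribed real part [c], when [|c| <= 1]: a
    contraction is the midpoint of two unimodular numbers. *)
Definition phase (c : R) : C := Complex c (Num.sqrt (1 - c ^+ 2)).

Lemma phase_unit c : `|c| <= 1 -> phase c * (phase c)^* = 1.
Proof.
move=> c1; rewrite mulrC conjMnormc normc2 /= sqr_sqrtr.
  by rewrite addrC subrK.
by rewrite subr_ge0 -real_normK ?num_real // expr_le1.
Qed.

Lemma phase_mid c : c%:C%C = 2^-1%:C%C * (phase c + (phase c)^*).
Proof. by apply/eqP; rewrite eq_complex /=; apply/andP; split; apply/eqP; lra. Qed.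
End Phase.

(** * Unitarily invariant norms *)

Section UINorm.
Context (R : realType).
Local Notation C := R[i].
Variables (n : nat) (N : 'M[C]_n -> R).
Hypothesis Nui : unitarily_invariant_norm N.
Let Nn : is_norm N := proj1 Nui.

Lemma unitarymx1 : 1%:M \is @unitarymx C n n.
Proof. by apply/unitarymxP; rewrite trmx1 map_mx1 mulmx1. Qed.

Lemma uinorm_mull U A : U \is unitarymx -> N (U *m A) = N A.
Proof. by move=> Uu; have := proj2 Nui U 1%:M A Uu unitarymx1; rewrite mulmx1. Qed.

Lemma uinorm_mulr U A : U \is unitarymx -> N (A *m U) = N A.
Proof. by move=> Uu; have := proj2 Nui 1%:M U A unitarymx1 Uu; rewrite mul1mx. Qed.

Lemma diag_unitary (z : 'rV[C]_n) : (forall i, z 0 i * (z 0 i)^* = 1) ->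
  diag_mx z \is unitarymx.
Proof.
move=> z1; apply/unitarymxP/matrixP => i j; rewrite mul_diag_mx !mxE.
rewrite [j == i]eq_sym.
by case: eqP => [<-|_]; rewrite ?mulr1n ?mulr0n ?z1 // conjC0 mulr0.
Qed.

(** A real diagonal matrix with entries at most [t] in modulus is the
    midpoint of [t] times two diagonal unitary matrices. *)
Lemma uinorm_rdiag_mul (t : R) (c : 'I_n -> R) A : 0 <= t ->
  (forall i, `|c i| <= t) -> N (rdiag c *m A) <= t * N A.
Proof.
rewrite le_eqVlt => /predU1P[<-|t0] ct.
  have -> : rdiag c *m A = 0; last by rewrite (norm0 Nn) mul0r.
  apply/matrixP => i j; rewrite rdiag_mulE mxE.
  by have := ct i; rewrite normr_le0 => /eqP ->; rewrite mul0r.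
pose z : 'rV[C]_n := \row_i phase (c i / t).
have zu i : z 0 i * (z 0 i)^* = 1.
  rewrite mxE; apply: phase_unit.
  by rewrite normrM normfV (gtr0_norm t0) ler_pdivrMr // mul1r.
have -> : rdiag c *m A =
    2^-1%:C%C *: (diag_mx z *m (t%:C%C *: A) +
                  diag_mx (map_mx Num.conj z) *m (t%:C%C *: A)).
  apply/matrixP => i j; rewrite rdiag_mulE !mul_diag_mx !mxE.
  rewrite -mulrDl mulrA -phase_mid mulrA -rmorphM /= mulfVK //.
  by rewrite gt_eqF.
apply: (norm_midpoint Nn); rewrite uinorm_mull ?norm_scale_ge0 ?(ltW t0) //.
  exact: diag_unitary.
by apply: diag_unitary => i; rewrite mxE conjCK mulrC.
Qed.

Lemma uinorm_rdiag_le (s t : 'I_n -> R) :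
  (forall i, 0 <= s i <= t i) -> N (rdiag s) <= N (rdiag t).
Proof.
move=> st; pose c i := s i / t i.
have -> : rdiag s = rdiag c *m rdiag t.
  apply/matrixP => i j; rewrite rdiag_mulE !mxE.
  case: eqP => [_|_]; rewrite ?mulr1n ?mulr0n ?mulr0 // -rmorphM /= /c.
  have [ti0|ti0] := eqVneq (t i) 0; last by rewrite divfK.
  by have := st i; rewrite ti0 mulr0 -eq_le => /eqP <-.
rewrite -[N (rdiag t)]mul1r; apply: uinorm_rdiag_mul => // i.
have /andP[s0 le] := st i; have t0 := le_trans s0 le.
rewrite ger0_norm ?divr_ge0 // /c.
have [->|ti0] := eqVneq (t i) 0; first by rewrite invr0 mulr0.
by rewrite ler_pdivrMr ?mul1r // lt_def ti0.
Qed.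

(** Only the diagonal and the block of the indices outside [r] survive. *)
Definition pinch (r : seq 'I_n) (A : 'M[C]_n) : 'M[C]_n :=
  \matrix_(i, j) (if (i == j) || (i \notin r) && (j \notin r) then A i j else 0).

(** Conjugating by the diagonal sign matrix that flips coordinate [k] and
    taking the midpoint kills the off-diagonal entries of row and column [k]. *)
Lemma uinorm_pinch r A : N (pinch r A) <= N A.
Proof.
elim: r => [|k r IH].
  by have -> // : pinch [::] A = A by apply/matrixP => i j; rewrite mxE orbT.
apply: le_trans IH; set B := pinch r A.
pose z : 'rV[C]_n := \row_i (if i == k then -1 else 1).
have zu : diag_mx z \is unitarymx.
  apply: diag_unitary => i; rewrite mxE; case: ifP => _.
    by rewrite rmorphN rmorph1 mulrNN mulr1.
  by rewrite rmorph1 mulr1.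
have -> : pinch (k :: r) A = 2^-1%:C%C *: (B + diag_mx z *m B *m diag_mx z).
  apply/matrixP => i j; rewrite mul_mx_diag mul_diag_mx !mxE.
  rewrite !inE !negb_or.
  have half (a : C) : a = 2^-1%:C%C * (a + a).
    apply/eqP; rewrite eq_complex; case: a => a b /=.
    by apply/andP; split; apply/eqP; lra.
  have [<-|ij] /= := eqVneq i j.
    by case: ifP => _; rewrite ?mulN1r ?mulrN1 ?opprK ?mulr1 ?mul1r -half.
  have [ik|ik] /= := eqVneq i k.
    have jk : j == k = false by rewrite -ik eq_sym; apply/negbTE.
    by rewrite jk mulr1 mulN1r subrr mulr0.
  have [jk|jk] /= := eqVneq j k.
    by rewrite andbF mul1r mulrN1 subrr mulr0.
  by rewrite mulr1 mul1r -half.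
apply: (norm_midpoint Nn) => //.
by rewrite uinorm_mulr // uinorm_mull.
Qed.

Lemma uinorm_diag (A : 'M[C]_n) : N (diag_mx (\row_i A i i)) <= N A.
Proof.
have <- : pinch (enum 'I_n) A = diag_mx (\row_i A i i); last exact: uinorm_pinch.
apply/matrixP => i j; rewrite !mxE !mem_enum !inE andbF orbF.
by case: eqP => // ->.
Qed.

(** The vector with entries [sum_k |U i k|^2 s k] is the diagonal of
    [U diag(s) U^H], and taking the diagonal part does not increase the norm. *)
Lemma uinorm_orthostochastic (U : 'M[C]_n) (s : 'I_n -> R) : U \is unitarymx ->
  N (rdiag (fun i => \sum_k normc (U i k) ^+ 2 * s k)) <= N (rdiag s).
Proof.
move=> Uu; have Uu' : U^t* \is unitarymx by rewrite trmxC_unitary.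
rewrite -[leRHS](uinorm_mull _ Uu) -[leRHS](uinorm_mulr _ Uu').
apply: le_trans (uinorm_diag _); rewrite le_eqVlt; apply/predU1l; congr N.
rewrite /rdiag; congr (diag_mx _); apply/rowP => i.
rewrite !mxE rmorph_sum; apply: eq_bigr => k _.
by rewrite mul_mx_diag !mxE rmorphM /= -conjMnormc; ring.
Qed.
End UINorm.

(** * Contractions and unitarily invariant norms *)

Section OpBoundNorm.
Context (R : realType).
Local Notation C := R[i].
Local Notation Re := (@complex.Re R).

Lemma rdiag_diag n (s : 'I_n -> R) i : rdiag s i i = (s i)%:C%C.
Proof. by rewrite !mxE eqxx. Qed.

Lemma svd_cancel n (U V A : 'M[C]_n) : U \is unitarymx -> V \is unitarymx ->
  U^t* *m (U *m A *m V) *m V^t* = A.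
Proof.
by move=> Uu Vu; rewrite !mulmxA (unitary_adj_mul Uu) mul1mx (mulmxtVK _ Vu).
Qed.

Lemma opbound_rdiag_le n c (s : 'I_n -> R) i : (forall i, 0 <= s i) -> 0 <= c ->
  opbound c (rdiag s) -> s i <= c.
Proof.
by move=> s0 c0 /(opbound_entry i i c0); rewrite rdiag_diag normc_real.
Qed.

Lemma opbound_rdiag n c (s : 'I_n -> R) : (forall i, 0 <= s i <= c) ->
  opbound c (rdiag s).
Proof.
move=> sc w v; rewrite sesqform_sum.
have -> : \sum_i \sum_j (w i 0)^* * rdiag s i j * v j 0 =
   \sum_i (s i)%:C%C * ((w i 0)^* * v i 0).
  apply: eq_bigr => i _; rewrite (bigD1 i) //= big1 ?addr0.
    by rewrite rdiag_diag; ring.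
  by move=> j /negPf ji; rewrite !mxE eq_sym ji mulr0n mulr0 mul0r.
rewrite Re_sum /sqn -big_split /= mulr_suml mulr_sumr; apply: ler_sum => i _.
have /andP[s0 sle] := sc i.
have h := Re_conjM_le (w i 0) (v i 0).
rewrite ReM /= mul0r subr0; apply: le_trans (ler_wpM2l s0 h) _.
by rewrite ler_wpM2r // divr_ge0 // addr_ge0 // exprn_ge0 // normc_ge0.
Qed.

Lemma svd_bounded n c (A : 'M[C]_n) : 0 <= c -> opbound c A ->
  exists U V : 'M[C]_n, exists s : 'I_n -> R,
  [/\ U \is unitarymx, V \is unitarymx, forall i, 0 <= s i <= c
    & A = U *m rdiag s *m V].
Proof.
move=> c0 Ac; have [U [V [s [Uu Vu s0 AE]]]] := svd A.
exists U, V, s; split; [exact: Uu|exact: Vu| |exact: AE] => i; rewrite s0 /=.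
apply: (opbound_rdiag_le i s0 c0); rewrite -(svd_cancel (rdiag s) Uu Vu) -AE.
exact: (opbound_mulr (opbound_mull (unitary_adj Uu) Ac) (unitary_adj Vu)).
Qed.

Variables (n : nat) (N : 'M[C]_n -> R).
Hypothesis Nui : unitarily_invariant_norm N.
Let Nn : is_norm N := proj1 Nui.

Lemma uinorm_opbound_mul c A M : 0 <= c -> opbound c A ->
  N (A *m M) <= c * N M.
Proof.
move=> c0 /(svd_bounded c0)[U [V [s [Uu Vu sc ->]]]].
rewrite -!mulmxA (uinorm_mull Nui _ Uu) -(uinorm_mull Nui M Vu).
apply: (uinorm_rdiag_mul Nui) => // i; have /andP[s0 sle] := sc i.
by rewrite ger0_norm.
Qed.

(** Take singular value decompositions [M = P diag(t) Q] and
    [A o M = V diag(s) W]. Then [s i] is the sum over [k] of [t k] times the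
    form of [A] at [w i k], the column [i] of [V] times the conjugate of the
    column [k] of [P], and [v i k], the row [k] of [Q] times the conjugate of the
    row [i] of [W]. Hence it is at most
    [c/2 * sum_k t k (|w i k|^2 + |v i k|^2)]. The matrices [|w i k|^2] and
    [|v i k|^2] are products of two orthostochastic matrices, so that [s] is
    dominated by [c] times the mean of two vectors of norm at most that of [t]. *)
Lemma uinorm_opbound_hadamard c A M : 0 <= c -> opbound c A ->
  N (hadamard A M) <= c * N M.
Proof.
move=> c0 Ac.
have [P [Q [t [Pu Qu t0 ME]]]] := svd M.
have [V [W [s [Vu Wu s0 XE]]]] := svd (hadamard A M).
have -> : N M = N (rdiag t) by rewrite ME (uinorm_mulr Nui _ Qu) (uinorm_mull Nui _ Pu).
rewrite XE (uinorm_mulr Nui _ Wu) (uinorm_mull Nui _ Vu).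
have Vu' := unitary_adj Vu; have Qu' := unitary_adj Qu.
pose o1 x i := \sum_k normc (V^t* i k) ^+ 2 * x k.
pose o2 x i := \sum_k normc (P i k) ^+ 2 * x k.
pose o3 x i := \sum_k normc (W i k) ^+ 2 * x k.
pose o4 x i := \sum_k normc (Q^t* i k) ^+ 2 * x k.
pose w i k : 'cV[C]_n := \col_a (V a i * (P a k)^*).
pose v i k : 'cV[C]_n := \col_b (Q k b * (W i b)^*).
have sE i : s i = \sum_k t k * Re (((w i k)^t* *m A *m v i k) 0 0).
  transitivity (Re ((V^t* *m hadamard A M *m W^t*) i i)).
    by rewrite XE (svd_cancel _ Vu Wu) rdiag_diag.
  transitivity (\sum_k Re ((t k)%:C%C * ((w i k)^t* *m A *m v i k) 0 0)); last first.
    by apply: eq_bigr => k _; rewrite ReM /= mul0r subr0.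
  rewrite -Re_sum; congr Re.
  have Mab a b : M a b = \sum_k (t k)%:C%C * (P a k * Q k b).
    rewrite ME mxE; apply: eq_bigr => k _.
    by rewrite mul_mx_diag !mxE mulrCA mulrA.
  transitivity (\sum_a \sum_b \sum_k
      (t k)%:C%C * ((w i k a 0)^* * A a b * v i k b 0)).
    rewrite mxE exchange_big; apply: eq_bigr => b _; rewrite !mxE mulr_suml.
    apply: eq_bigr => a _; rewrite !mxE Mab !(mulr_sumr, mulr_suml).
    apply: eq_bigr => k _; rewrite !mxE rmorphM /= conjCK; ring.
  rewrite exchange_big /=; under eq_bigr do rewrite exchange_big /=.
  rewrite exchange_big /=; apply: eq_bigr => k _.
  rewrite sesqform_sum mulr_sumr exchange_big; apply: eq_bigr => a _.
  by rewrite mulr_sumr.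
have sqn_w i k : sqn (w i k) = \sum_a normc (V^t* i a) ^+ 2 * normc (P a k) ^+ 2.
  apply: eq_bigr => a _.
  by rewrite !mxE normcM !normc_conj exprMn.
have sqn_v i k : sqn (v i k) = \sum_b normc (W i b) ^+ 2 * normc (Q^t* b k) ^+ 2.
  apply: eq_bigr => b _.
  by rewrite !mxE normcM !normc_conj exprMn mulrC.
have o12 i : o1 (o2 t) i = \sum_k t k * sqn (w i k).
  transitivity (\sum_a \sum_k t k * (normc (V^t* i a) ^+ 2 * normc (P a k) ^+ 2)).
    by apply: eq_bigr => a _; rewrite mulr_sumr; apply: eq_bigr => k _; ring.
  by rewrite exchange_big; apply: eq_bigr => k _; rewrite sqn_w mulr_sumr.
have o34 i : o3 (o4 t) i = \sum_k t k * sqn (v i k).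
  transitivity (\sum_b \sum_k t k * (normc (W i b) ^+ 2 * normc (Q^t* b k) ^+ 2)).
    by apply: eq_bigr => b _; rewrite mulr_sumr; apply: eq_bigr => k _; ring.
  by rewrite exchange_big; apply: eq_bigr => k _; rewrite sqn_v mulr_sumr.
have sle i : s i <= c * (2^-1 * (o1 (o2 t) i + o3 (o4 t) i)).
  rewrite sE o12 o34 -big_split /= !mulr_sumr; apply: ler_sum => k _.
  rewrite -mulrDr.
  have -> : c * (2^-1 * (t k * (sqn (w i k) + sqn (v i k)))) =
    t k * (c * ((sqn (w i k) + sqn (v i k)) / 2)) by ring.
  by apply: ler_wpM2l.
apply: le_trans (uinorm_rdiag_le Nui
  (t := fun i => c * (2^-1 * (o1 (o2 t) i + o3 (o4 t) i))) _) _.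
  by move=> i; rewrite s0 sle.
have -> : rdiag (fun i => c * (2^-1 * (o1 (o2 t) i + o3 (o4 t) i))) =
    c%:C%C *: (2^-1%:C%C *: (rdiag (o1 (o2 t)) + rdiag (o3 (o4 t)))) :> 'M[C]_n.
  apply/matrixP => i j; rewrite !mxE.
  by case: eqP => _; rewrite ?mulr1n ?mulr0n ?addr0 ?mulr0 // !(rmorphM, rmorphD).
rewrite (norm_scale_ge0 Nn _ c0) ler_wpM2l // (norm_midpoint Nn) //.
  apply: le_trans (uinorm_orthostochastic Nui _ Vu') _.
  exact: uinorm_orthostochastic.
apply: le_trans (uinorm_orthostochastic Nui _ Wu) _.
exact: uinorm_orthostochastic.
Qed.

Lemma perm_mx_unitary (u : 'S_n) : perm_mx u \is @unitarymx C n n.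
Proof.
apply/unitarymxP; rewrite tr_perm_mx map_perm_mx -perm_mxM mulgV.
exact: perm_mx1.
Qed.

Lemma uinorm_E11_gt0 : (0 < n)%N -> 0 < N (@E11 R n).
Proof.
move=> n0; rewrite lt_def (is_norm_ge0 Nn) andbT; apply/eqP => /(is_norm_eq0 Nn).
move=> /matrixP /(_ (Ordinal n0) (Ordinal n0)); rewrite !mxE /=.
by move/eqP; rewrite oner_eq0.
Qed.

(** The norm of [diag(s)] dominates that of the diagonal matrix keeping only
    the entry [s i], and a transposition of the coordinates turns the latter
    into [s i * E11]. *)
Lemma uinorm_rdiag_ge (s : 'I_n -> R) i : (forall i, 0 <= s i) ->
  s i * N (@E11 R n) <= N (rdiag s).
Proof.
move=> s0; have n0 : (0 < n)%N by case: i => i /=; case: (n).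
pose i0 := Ordinal n0; pose u := tperm i i0.
pose e k : R := if k == i then s i else 0.
apply: le_trans (uinorm_rdiag_le Nui (s := e) _); last first.
  by move=> k; rewrite /e; case: eqP => [->|_]; rewrite ?lexx ?s0.
have -> : rdiag e = (s i)%:C%C *: (perm_mx u *m (@E11 R n *m perm_mx u^-1)).
  apply/matrixP => a b; rewrite -col_permE -row_permE !mxE.
  have ui k : (u k == 0%N :> nat) = (k == i).
    transitivity (u k == u i); last by rewrite (inj_eq perm_inj).
    by rewrite [u i]tpermL.
  rewrite !ui /e; case: (eqVneq a b) => [->|ab].
    by rewrite andbb; case: eqP; rewrite ?mulr1 ?mulr0.
  rewrite mulr0n; case: eqP => [ai|]; last by rewrite mulr0.
  by rewrite -ai [b == a]eq_sym (negPf ab) mulr0.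
rewrite (norm_scale_ge0 Nn) // (uinorm_mull Nui _ (perm_mx_unitary u)).
by rewrite (uinorm_mulr Nui _ (perm_mx_unitary u^-1)).
Qed.

Lemma uinorm_opbound X : (0 < n)%N -> opbound (N X / N (@E11 R n)) X.
Proof.
move=> n0; have [U [V [s [Uu Vu s0 XE]]]] := svd X.
have -> : N X = N (rdiag s) by rewrite XE (uinorm_mulr Nui _ Vu) (uinorm_mull Nui _ Uu).
rewrite XE; apply: (opbound_mulr _ Vu); apply: (opbound_mull Uu).
apply: opbound_rdiag => i; rewrite s0 /= ler_pdivlMr ?uinorm_E11_gt0 //.
exact: uinorm_rdiag_ge.
Qed.

Lemma hadamardA m k (A B D : 'M[C]_(m, k)) :
  hadamard (hadamard A B) D = hadamard A (hadamard B D).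
Proof. by apply/matrixP => i j; rewrite !mxE mulrA. Qed.

(** The products with [U] are absorbed either in [A], keeping its operator
    bound, or in [X], not increasing its norm; Hadamard products are associative. *)
Lemma uinorm_dot3 o c A U X : 0 <= c -> opbound c A -> U \is unitarymx ->
  N (dot3 o A U X) <= c * N X.
Proof.
move=> c0 Ac Uu; have U1 := opbound_unitary Uu.
have UX : N (hadamard U X) <= N X.
  by rewrite -[leRHS]mul1r; apply: uinorm_opbound_hadamard.
case: o => /=.
- rewrite hadamardA; apply: le_trans (uinorm_opbound_hadamard _ c0 Ac) _.
  exact: ler_wpM2l.
- exact: (uinorm_opbound_mul _ c0 (opbound_mulr Ac Uu)).
- rewrite -[N X](uinorm_mull Nui _ Uu).
  exact: (uinorm_opbound_hadamard _ c0 Ac).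
- apply: le_trans (uinorm_opbound_mul _ c0 Ac) _.
  exact: ler_wpM2l.
- exact: (uinorm_opbound_mul _ c0 (opbound_hadamard c0 Ac Uu)).
- exact: (uinorm_opbound_hadamard _ c0 (opbound_mulr Ac Uu)).
Qed.

End OpBoundNorm.

(** * Generalized matrix functions *)

Section Tensor.
Context (R : realType) (d : nat).
Local Notation C := R[i].
Local Notation F := {ffun 'I_d -> 'I_d}.

Let ev (a : 'I_#|{: F}|) : F := enum_val a.

(** The [d]-th tensor power of [A], its indices being the maps from ['I_d] to
    itself. *)
Definition tensor_power (A : 'M[C]_d) : 'M[C]_#|{: F}| :=
  \matrix_(a, b) \prod_i A (ev a i) (ev b i).

Lemma tensor_power_mul A B : tensor_power (A *m B) = tensor_power A *m tensor_power B.
Proof.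
apply/matrixP => a b; rewrite !mxE; under eq_bigr do rewrite mxE.
rewrite bigA_distr_bigA /= (reindex _ (onW_bij _ (@enum_val_bij F))) /=.
by apply: eq_bigr => k _; rewrite !mxE big_split.
Qed.

Lemma tensor_power_adj A : (tensor_power A)^t* = tensor_power (A^t*).
Proof.
apply/matrixP => a b; rewrite !mxE rmorph_prod.
by apply: eq_bigr => i _; rewrite !mxE.
Qed.

Lemma tensor_power_rdiag (s : 'I_d -> R) :
  tensor_power (rdiag s) = rdiag (fun a => \prod_i s (ev a i)).
Proof.
apply/matrixP => a b; rewrite !mxE.
have [<-|ab] := eqVneq a b.
  rewrite mulr1n rmorph_prod; apply: eq_bigr => i _.
  by rewrite !mxE eqxx.
have [i abi] : exists i, ev a i != ev b i.
  apply/existsP; apply: contraNT ab; rewrite negb_exists => /forallP ab.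
  by apply/eqP/enum_val_inj/ffunP => i; apply/eqP; have := ab i; rewrite negbK.
by rewrite (bigD1 i) //= !mxE (negPf abi) mul0r.
Qed.

Lemma rdiag1 n : rdiag (fun=> 1) = 1%:M :> 'M[C]_n.
Proof. by apply/matrixP => i j; rewrite !mxE. Qed.

Lemma tensor_power1 : tensor_power 1%:M = 1%:M.
Proof.
rewrite -rdiag1 tensor_power_rdiag -rdiag1; congr (diag_mx _).
apply/rowP => i; rewrite !mxE.
by rewrite big1.
Qed.

Lemma tensor_power_unitary U : U \is unitarymx -> tensor_power U \is unitarymx.
Proof.
move=> /unitarymxP UU; apply/unitarymxP.
by rewrite tensor_power_adj -tensor_power_mul UU tensor_power1.
Qed.

(** Tensor powers are multiplicative and preserve unitary matrices, so the
    singular values of the tensor power are the products of [d] singular values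
    of [A]. *)
Lemma opbound_tensor_power c A : 0 <= c -> opbound c A ->
  opbound (c ^+ d) (tensor_power A).
Proof.
move=> c0 /(svd_bounded c0)[U [V [s [Uu Vu sc ->]]]]; rewrite !tensor_power_mul.
apply: (opbound_mulr _ (tensor_power_unitary Vu)).
apply: (opbound_mull (tensor_power_unitary Uu)).
rewrite tensor_power_rdiag; apply: opbound_rdiag => a; apply/andP; split.
  by apply: prodr_ge0 => i _; have /andP[] := sc (ev a i).
rewrite -[in leRHS](card_ord d) -prodr_const; exact: ler_prod.
Qed.

Variables (H : {group 'S_d}) (chi : 'S_d -> C).
Hypothesis chiP : degree1_character H chi.

Lemma chi1 : chi 1%g = 1.
Proof.
have [chiM [s sH s0]] := chiP; apply: (mulfI s0).
by rewrite mulr1 -chiM ?group1 ?mulg1.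
Qed.

(** The values of [chi] on the finite group [H] are roots of unity. *)
Lemma chi_norm s : s \in H -> normc (chi s) = 1.
Proof.
move=> sH; have [chiM _] := chiP.
have chiX k : chi (s ^+ k)%g = chi s ^+ k.
  elim: k => [|k IH]; first by rewrite expg0 expr0 chi1.
  by rewrite expgS exprS chiM ?groupX // IH.
have normX k : normc (chi s ^+ k) = normc (chi s) ^+ k.
  by elim: k => [|k IH]; rewrite ?expr0 ?normc1 // !exprS normcM IH.
have := normX #[s]%g; rewrite -chiX expg_order chi1 normc1 => /esym/eqP.
by rewrite pexpr_eq1 ?order_gt0 ?normc_ge0 // => /eqP.
Qed.

Let rank_perm (s : 'S_d) : 'I_#|{: F}| := enum_rank [ffun i => s i].

Lemma rank_perm_inj : injective rank_perm.
Proof.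
move=> s t /enum_rank_inj /ffunP st; apply/permP => i.
by have := st i; rewrite !ffunE.
Qed.

Let vchi : 'cV[C]_#|{: F}| := \sum_(s in H) chi s *: delta_mx (rank_perm s) 0.

Lemma vchi_form (B : 'M[C]_#|{: F}|) : (vchi^t* *m B *m vchi) 0 0 =
  \sum_(s in H) \sum_(t in H) (chi s)^* * chi t * B (rank_perm s) (rank_perm t).
Proof.
have -> : vchi^t* = \sum_(s in H) (chi s)^* *: delta_mx 0 (rank_perm s).
  rewrite /vchi !raddf_sum /=; apply: eq_bigr => s _.
  by rewrite linearZ /= map_mxZ trmx_delta map_delta_mx.
rewrite !mulmx_suml summxE; apply: eq_bigr => s _.
rewrite mulmx_sumr summxE; apply: eq_bigr => t _.
by rewrite -scalemxAl -scalemxAl -scalemxAr -rowE -colE !mxE; ring.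
Qed.

Lemma sqn_vchi : sqn vchi = #|H|%:R.
Proof.
apply: (@complexI R); rewrite -sqnE -[vchi^t*]mulmx1 vchi_form rmorph_nat.
rewrite -sum1_card natr_sum; apply: eq_bigr => s sH.
rewrite (bigD1 s) //= mxE eqxx mulr1 conjMnormc (chi_norm sH) expr1n big1 ?addr0 //.
move=> t /andP[_ ts]; rewrite mxE (inj_eq rank_perm_inj) eq_sym (negPf ts).
by rewrite mulr0.
Qed.

(** The generalized matrix function as a value of the sesquilinear form of
    the tensor power: in the double sum over [s] and [t] in [H], the substitution
    [t := s * t] makes each [s] contribute the same sum. *)
Lemma vchi_tensor_power A : (vchi^t* *m tensor_power A *m vchi) 0 0 =
  #|H|%:R * gen_matrix_fun H chi A.
Proof.
have [chiM _] := chiP.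
rewrite vchi_form -sum1_card natr_sum mulr_suml; apply: eq_bigr => s sH.
rewrite mul1r (reindex_inj (mulgI s)) /=.
under eq_bigl do rewrite groupMl //.
apply: eq_bigr => t tH; rewrite chiM // mulrA conjMnormc (chi_norm sH) expr1n.
rewrite mul1r mxE; congr (_ * _).
rewrite [RHS](reindex_inj (@perm_inj _ s)) /=; apply: eq_bigr => i _.
by rewrite /ev !enum_rankK !ffunE permM.
Qed.

Lemma gen_matrix_fun_le c A : 0 <= c -> opbound c A ->
  normc (gen_matrix_fun H chi A) <= c ^+ d.
Proof.
move=> c0 Ac.
have := opbound_norm vchi vchi (exprn_ge0 d c0) (opbound_tensor_power c0 Ac).
rewrite vchi_tensor_power sqn_vchi normcM.
have -> : normc (#|H|%:R : C) = #|H|%:R.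
  by rewrite -(rmorph_nat (real_complex R)) normc_real.
have -> : (#|H|%:R + #|H|%:R) / 2 = #|H|%:R :> R by lra.
by rewrite mulrC ler_pM2r // ltr0n cardG_gt0.
Qed.

End Tensor.

(** * Symmetric gauge functions *)

Section Gauge.
Context (R : realType).
Local Notation C := R[i].

Lemma gauge_eq_abs k (phi : 'rV[C]_k -> R) (v w : 'rV[C]_k) : symmetric_gauge phi ->
  (forall j, normc (v 0 j) = normc (w 0 j)) -> phi v = phi w.
Proof.
move=> [_ phi_abs _] vw; rewrite phi_abs [RHS]phi_abs; congr phi.
by apply/rowP => j; rewrite !mxE -!normcC vw.
Qed.

(** [|v|] is [|w|] scaled by factors in [0, 1], each of which is the midpoint
    of two unimodular numbers; these do not change the gauge. *)
Lemma gauge_mono k (phi : 'rV[C]_k -> R) (v w : 'rV[C]_k) : symmetric_gauge phi ->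
  (forall j, normc (v 0 j) <= normc (w 0 j)) -> phi v <= phi w.
Proof.
move=> phiG vw; have [phiN _ _] := phiG.
pose c j := normc (v 0 j) / normc (w 0 j).
have c1 j : `|c j| <= 1.
  rewrite ger0_norm ?divr_ge0 ?normc_ge0 // /c.
  have [->|w0] := eqVneq (normc (w 0 j)) 0; first by rewrite invr0 mulr0.
  by rewrite ler_pdivrMr ?mul1r // lt_def w0 normc_ge0.
pose z j := phase (c j).
have z1 j : normc (z j) = 1.
  apply/eqP; rewrite -(@pexpr_eq1 _ _ 2) ?normc_ge0 //; apply/eqP.
  apply: (@complexI R); rewrite -conjMnormc mulrC; exact: phase_unit.
pose u : 'rV[C]_k := \row_j (z j * w 0 j).
pose u' : 'rV[C]_k := \row_j ((z j)^* * w 0 j).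
have -> : phi v = phi (2^-1%:C%C *: (u + u')).
  apply: gauge_eq_abs => // j; rewrite !mxE -mulrDl mulrA -phase_mid normcM.
  rewrite normc_real ?divr_ge0 ?normc_ge0 // /c.
  have [w0|w0] := eqVneq (normc (w 0 j)) 0; last by rewrite divfK.
  by apply/eqP; rewrite w0 mulr0 eq_le normc_ge0 -w0 vw.
apply: norm_midpoint => //; rewrite le_eqVlt; apply/predU1l.
  by apply: gauge_eq_abs => // j; rewrite mxE normcM z1 mul1r.
by apply: gauge_eq_abs => // j; rewrite mxE normcM normc_conj z1 mul1r.
Qed.

Variables (d : nat) (phi : 'rV[C]_(d * d) -> R).
Hypothesis phiG : symmetric_gauge phi.
Let phiN : is_norm phi. Proof. by case: phiG. Qed.

Lemma gauge_mx_mono (A B : 'M[C]_d) :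
  (forall i j, normc (A i j) <= normc (B i j)) -> phi (mxvec A) <= phi (mxvec B).
Proof.
move=> AB; apply: gauge_mono => // k.
by case/mxvec_indexP: k => i j; rewrite !mxvecE.
Qed.

Lemma gauge_scale_le c (A B : 'M[C]_d) : 0 <= c ->
  (forall i j, normc (A i j) <= c * normc (B i j)) ->
  phi (mxvec A) <= c * phi (mxvec B).
Proof.
move=> c0 AB; rewrite -(norm_scale_ge0 phiN) // -linearZ /=.
by apply: gauge_mx_mono => i j; rewrite mxE normcM normc_real.
Qed.

Lemma gauge_hadamard c (A M : 'M[C]_d) : 0 <= c ->
  (forall i j, normc (A i j) <= c) ->
  phi (mxvec (hadamard A M)) <= c * phi (mxvec M).
Proof.
move=> c0 Ac; apply: gauge_scale_le => // i j; rewrite mxE normcM.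
by rewrite ler_wpM2r ?normc_ge0.
Qed.

(** A permutation of the rows is a permutation of the entries, carried by
    the indices [mxvec_index i j]. *)
Lemma gauge_row_perm (u : 'S_d) (M : 'M[C]_d) :
  phi (mxvec (row_perm u M)) = phi (mxvec M).
Proof.
pose g (k : 'I_(d * d)) : 'I_(d * d) :=
  let ij := enum_val (cast_ord (esym (mxvec_cast d d)) k) in
  mxvec_index (u ij.1) ij.2.
have gE i j : g (mxvec_index i j) = mxvec_index (u i) j.
  by rewrite /g /mxvec_index cast_ordK enum_rankK.
have g_inj : injective g.
  move=> k l; case/mxvec_indexP: k => i j; case/mxvec_indexP: l => i' j'.
  rewrite !gE => /cast_ord_inj/enum_rank_inj[] /perm_inj -> ->.
  by [].
have [_ _ phi_perm] := phiG; rewrite -[RHS](phi_perm (perm g_inj)); congr phi.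
apply/rowP => k; case/mxvec_indexP: k => i j.
by rewrite mxvecE !mxE permE gE mxvecE.
Qed.

(** [A M] is the sum of the [d^2] matrices having the row [k] of [M],
    multiplied by [A i k], as their row [i] and zeros elsewhere. Up to a
    permutation of rows such a matrix is dominated entrywise by [c M]. *)
Lemma gauge_mul c (A M : 'M[C]_d) : 0 <= c ->
  (forall i j, normc (A i j) <= c) ->
  phi (mxvec (A *m M)) <= d%:R ^+ 2 * (c * phi (mxvec M)).
Proof.
move=> c0 Ac; rewrite {1}(matrix_sum_delta A) mulmx_suml raddf_sum /=.
have -> : d%:R ^+ 2 * (c * phi (mxvec M)) =
    \sum_(i < d) \sum_(k < d) c * phi (mxvec M).
  by rewrite !sumr_const !card_ord -mulrnA -[RHS]mulr_natl natrM expr2.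
apply: le_trans (norm_sum phiN _ _ _) _; apply: ler_sum => i _.
rewrite mulmx_suml raddf_sum /=.
apply: le_trans (norm_sum phiN _ _ _) _; apply: ler_sum => k _.
rewrite -(gauge_row_perm (tperm i k) M); apply: gauge_scale_le => // a b.
rewrite -scalemxAl mxE normcM; apply: ler_pM; rewrite ?normc_ge0 //.
rewrite mxE (bigD1 k) //= big1 ?addr0; last first.
  by move=> l /negPf lk; rewrite mxE lk andbF mul0r.
rewrite !mxE eqxx andbT normcM; case: eqP => [->|_].
  by rewrite tpermL normc1 mul1r.
by rewrite normc0 mul0r normc_ge0.
Qed.

Lemma gauge_dot3 o c (A U X : 'M[C]_d) : (0 < d)%N -> 0 <= c -> opbound c A ->
  U \is unitarymx ->
  phi (mxvec (dot3 o A U X)) <= c * (d%:R ^+ 2 * phi (mxvec X)).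
Proof.
move=> d0 c0 Ac Uu.
have U1 i j : normc (U i j) <= 1 by apply: opbound_entry => //; exact: opbound_unitary.
have Ae i j := opbound_entry i j c0 Ac.
have AUe i j := opbound_entry i j c0 (opbound_mulr Ac Uu).
have AoUe i j := opbound_entry i j c0 (opbound_hadamard c0 Ac Uu).
have UX : phi (mxvec (hadamard U X)) <= phi (mxvec X).
  by rewrite -[leRHS]mul1r; apply: gauge_hadamard.
have X0 : 0 <= phi (mxvec X) by apply: (is_norm_ge0 phiN).
have d2 : 1 <= d%:R ^+ 2 :> R by rewrite expr_ge1 // ler1n.
have d20 : 0 <= d%:R ^+ 2 :> R by exact: le_trans ler01 d2.
have had : c * phi (mxvec X) <= c * (d%:R ^+ 2 * phi (mxvec X)).
  by rewrite ler_wpM2l // ler_peMl.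
have swap : d%:R ^+ 2 * (c * phi (mxvec X)) = c * (d%:R ^+ 2 * phi (mxvec X)).
  by rewrite mulrCA.
case: o => /=.
- by rewrite (le_trans _ had) // gauge_hadamard.
- by rewrite -swap gauge_mul.
- apply: le_trans (gauge_hadamard _ c0 Ae) _; rewrite ler_wpM2l //.
  by rewrite -[X in d%:R ^+ 2 * X]mul1r gauge_mul.
- apply: le_trans (gauge_mul _ c0 Ae) _; rewrite -swap.
  by rewrite !ler_wpM2l.
- by rewrite -swap gauge_mul.
- by rewrite (le_trans _ had) // gauge_hadamard.
Qed.

End Gauge.

(** * Linearity of the complex integral *)

Section ComplexIntegrals.
Context dT (T : measurableType dT) (R : realType) (mu : {measure set T -> \bar R}).
Local Notation C := R[i].
Local Notation Re := (@complex.Re R).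
Local Notation Im := (@complex.Im R).

Definition Cintegrable (f : T -> C) :=
  mu.-integrable setT (EFin \o (Re \o f)) /\ mu.-integrable setT (EFin \o (Im \o f)).

Lemma Rintegrable_sum I (r : seq I) (h : I -> T -> R) :
  (forall i, mu.-integrable setT (EFin \o h i)) ->
  mu.-integrable setT (EFin \o (fun x => \sum_(i <- r) h i x)).
Proof.
move=> hi; have := @integrable_sum _ _ _ mu setT measurableT I r xpredT
  (fun i => EFin \o h i) (fun i _ => hi i).
apply: eq_integrable => // x _ /=; by rewrite sumEFin.
Qed.

Lemma Rintegral_sum I (r : seq I) (h : I -> T -> R) :
  (forall i, mu.-integrable setT (EFin \o h i)) ->
  Rintegral mu setT (fun x => \sum_(i <- r) h i x) =
  \sum_(i <- r) Rintegral mu setT (h i).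
Proof.
move=> hi; elim: r => [|i r IH].
  rewrite big_nil; under eq_Rintegral do rewrite big_nil.
  by rewrite Rintegral_cst // mul0r.
under eq_Rintegral do rewrite big_cons.
by rewrite RintegralD ?big_cons ?IH //; exact: Rintegrable_sum.
Qed.

Lemma Cintegrable_sum I (r : seq I) (h : I -> T -> C) :
  (forall i, Cintegrable (h i)) -> Cintegrable (fun x => \sum_(i <- r) h i x).
Proof.
move=> hi; split.
  have := Rintegrable_sum r (fun i => proj1 (hi i)).
  by apply: eq_integrable => // x _ /=; rewrite Re_sum.
have := Rintegrable_sum r (fun i => proj2 (hi i)).
by apply: eq_integrable => // x _ /=; rewrite Im_sum.
Qed.

Lemma Cintegral_sum I (r : seq I) (h : I -> T -> C) :
  (forall i, Cintegrable (h i)) ->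
  Cintegral mu (fun x => \sum_(i <- r) h i x) = \sum_(i <- r) Cintegral mu (h i).
Proof.
move=> hi; apply/eqP; rewrite eq_complex Re_sum Im_sum /=; apply/andP; split; apply/eqP.
  under eq_Rintegral do rewrite Re_sum.
  exact: (Rintegral_sum r (fun i => proj1 (hi i))).
under eq_Rintegral do rewrite Im_sum.
exact: (Rintegral_sum r (fun i => proj2 (hi i))).
Qed.

Lemma RintegrableZ (k : R) (h : T -> R) : mu.-integrable setT (EFin \o h) ->
  mu.-integrable setT (EFin \o (fun x => k * h x)).
Proof. by move=> /(integrableZl measurableT k). Qed.

Lemma RintegrableD (h k : T -> R) : mu.-integrable setT (EFin \o h) ->
  mu.-integrable setT (EFin \o k) -> mu.-integrable setT (EFin \o (fun x => h x + k x)).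
Proof. by move=> hi ki; have := integrableD measurableT hi ki. Qed.

Lemma RintegrableB (h k : T -> R) : mu.-integrable setT (EFin \o h) ->
  mu.-integrable setT (EFin \o k) -> mu.-integrable setT (EFin \o (fun x => h x - k x)).
Proof. by move=> hi ki; have := integrableB measurableT hi ki. Qed.

Lemma CintegrableZ (c : C) h : Cintegrable h -> Cintegrable (fun x => c * h x).
Proof.
move=> [h1 h2]; split.
  apply: eq_integrable
    (RintegrableB (RintegrableZ (Re c) h1) (RintegrableZ (Im c) h2)) => //.
  by move=> x _ /=; rewrite ReM.
apply: eq_integrable
  (RintegrableD (RintegrableZ (Re c) h2) (RintegrableZ (Im c) h1)) => //.
by move=> x _ /=; rewrite ImM.
Qed.

Lemma CintegralZ (c : C) h : Cintegrable h ->
  Cintegral mu (fun x => c * h x) = c * Cintegral mu h.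
Proof.
move=> [h1 h2]; apply/eqP; rewrite eq_complex ReM ImM /=; apply/andP; split; apply/eqP.
  under eq_Rintegral do rewrite ReM.
  by rewrite RintegralB ?RintegralZl //; exact: RintegrableZ.
under eq_Rintegral do rewrite ImM.
by rewrite RintegralD ?RintegralZl //; exact: RintegrableZ.
Qed.

Lemma Cintegrable_conj h : Cintegrable h -> Cintegrable (fun x => (h x)^*).
Proof.
move=> [h1 h2]; split.
  by apply: eq_integrable h1 => // x _ /=; rewrite Re_conj.
apply: eq_integrable (RintegrableZ (-1) h2) => // x _ /=.
by rewrite Im_conj mulN1r.
Qed.

Lemma Cintegral_conj h : Cintegrable h ->
  Cintegral mu (fun x => (h x)^*) = (Cintegral mu h)^*.
Proof.
move=> [h1 h2]; apply/eqP; rewrite eq_complex Re_conj Im_conj /=.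
apply/andP; split; apply/eqP.
  by under eq_Rintegral do rewrite Re_conj.
under eq_Rintegral do rewrite Im_conj -mulN1r.
by rewrite RintegralZl // mulN1r.
Qed.

Lemma CintegralD h k : Cintegrable h -> Cintegrable k ->
  Cintegral mu (fun x => h x + k x) = Cintegral mu h + Cintegral mu k.
Proof.
move=> [h1 h2] [k1 k2]; apply/eqP; rewrite eq_complex /=; apply/andP; split; apply/eqP.
  by rewrite -RintegralD //; apply: eq_Rintegral => x _ /=; rewrite ReD.
rewrite -RintegralD //; apply: eq_Rintegral => x _ /=.
by case: (h x); case: (k x).
Qed.

Lemma CintegrableD h k : Cintegrable h -> Cintegrable k ->
  Cintegrable (fun x => h x + k x).
Proof.
move=> [h1 h2] [k1 k2]; split.
  apply: eq_integrable (RintegrableD h1 k1) => // x _ /=; by rewrite ReD.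
apply: eq_integrable (RintegrableD h2 k2) => // x _ /=.
by case: (h x); case: (k x).
Qed.

Lemma eq_Cintegral (h k : T -> C) : h =1 k -> Cintegral mu h = Cintegral mu k.
Proof. by move=> hk; congr Cintegral; apply/funext. Qed.

Lemma Cintegral_form n (F : T -> 'M[C]_n) (w v : 'cV[C]_n) :
  (forall i j, Cintegrable (fun y => F y i j)) ->
  (w^t* *m (\matrix_(i, j) Cintegral mu (fun y => F y i j)) *m v) 0 0 =
  Cintegral mu (fun y => (w^t* *m F y *m v) 0 0) /\
  Cintegrable (fun y => (w^t* *m F y *m v) 0 0).
Proof.
move=> Fi; set g := fun y => (w^t* *m F y *m v) 0 0.
have gE : g = fun y => \sum_i \sum_j ((w i 0)^* * v j 0) * F y i j.
  apply/funext => y; rewrite /g sesqform_sum; apply: eq_bigr => i _.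
  by apply: eq_bigr => j _; rewrite mulrAC.
have gi i j : Cintegrable (fun y => ((w i 0)^* * v j 0) * F y i j) by exact: CintegrableZ.
rewrite gE; split; last by do 2!apply: Cintegrable_sum => ?.
rewrite sesqform_sum Cintegral_sum; last by move=> i; apply: Cintegrable_sum.
apply: eq_bigr => i _; rewrite Cintegral_sum //; apply: eq_bigr => j _.
by rewrite CintegralZ // mxE mulrAC.
Qed.

Lemma integrable_bounded_mul (u h : T -> R) (M : R) :
  mu.-integrable setT (EFin \o u) -> measurable_fun setT h -> (forall y, `|h y| <= M) ->
  mu.-integrable setT (EFin \o (fun y => u y * h y)).
Proof.
move=> ui mh hM; apply: (integrableMl measurableT ui mh).
exists M; split; first exact: num_real.
by move=> K MK y _; apply: le_trans (hM y) (ltW MK).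
Qed.

(** The nonnegative part of [k - h] agrees with [k - h] almost everywhere. *)
Lemma ae_le_Rintegral (h k : T -> R) : mu.-integrable setT (EFin \o h) ->
  mu.-integrable setT (EFin \o k) -> {ae mu, forall y, h y <= k y} ->
  Rintegral mu setT h <= Rintegral mu setT k.
Proof.
move=> hi ki hk; rewrite -subr_ge0 -RintegralB //.
have di := RintegrableB ki hi.
have md := measurable_int mu di.
rewrite /Rintegral (_ : integral mu setT _ =
  integral mu setT (fun y => (Num.max 0 (k y - h y))%:E)).
  by apply: Rintegral_ge0 => x _; rewrite le_max lexx.
apply: ae_eq_integral => //.
  apply/measurable_EFinP; apply: measurable_maxr; first exact: measurable_cst.
  exact/measurable_EFinP.
apply: filterS hk => x hkx _ /=; congr (_%:E).
by rewrite max_r // subr_ge0.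
Qed.
End ComplexIntegrals.

(** * Haar averages of representations *)

Section GroupIntegrals.
Context (R : realType) (G : topologicalGroupType).
Local Notation C := R[i].
Local Notation Re := (@complex.Re R).
Local Notation Im := (@complex.Im R).
Variables (mu : probability (borel G) R).
Hypothesis mu_haar : haar_probability mu.

Lemma continuous_borel_measurable (h : G -> R) : continuous h ->
  measurable_fun setT (h : borel G -> R).
Proof.
move=> /continuousP ch; apply: (measurability _ (RGenOpens.measurableE R)).
move=> _ [_ [a [b ->] <-]]; rewrite setTI.
by apply: sub_sigma_algebra; apply: ch; exact: interval_open.
Qed.

Lemma Re_continuous : continuous (Re : C^o -> R).
Proof.
move=> z; apply: (proj2 (@cvgrPdist_lt _ _ _ _ (@nbhs_filter C^o z) _ _)) => e e0.
apply/nbhs_ballP; exists e%:C%C => /=; first by rewrite ltcR.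
move=> w; rewrite -ball_normE /= -normcC ltcR; apply: le_lt_trans.
have -> : Re z - Re w = Re (z - w) by rewrite ReD ReN.
exact: normRe_le.
Qed.

Lemma Im_continuous : continuous (Im : C^o -> R).
Proof.
move=> z; apply: (proj2 (@cvgrPdist_lt _ _ _ _ (@nbhs_filter C^o z) _ _)) => e e0.
apply/nbhs_ballP; exists e%:C%C => /=; first by rewrite ltcR.
move=> w; rewrite -ball_normE /= -normcC ltcR; apply: le_lt_trans.
have -> : Im z - Im w = Im (z - w) by case: (z); case: (w).
exact: normIm_le.
Qed.

Lemma mulgl_continuous (g : G) : continuous (fun y : G => (g * y)%g).
Proof.
move=> y; have := @mulg_continuous G (g, y).
apply: (@cvg_comp _ _ _ (fun y : G => (g, y)) (fun p : G * G => (p.1 * p.2)%g)).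
by apply: cvg_pair; [exact: cvg_cst|exact: cvg_id].
Qed.

Lemma mulgl_measurable (g : G) :
  measurable_fun setT ((fun y => (g * y)%g) : borel G -> borel G).
Proof.
apply: (@measurability _ _ (borel G) (borel G) setT (fun y => (g * y)%g)
  (@open G)) => // _ [B oB <-].
rewrite setTI; apply: sub_sigma_algebra.
by have /continuousP := @mulgl_continuous g; exact.
Qed.

(** Left invariance says that the image measure of [mu] under translation
    is [mu]. *)
Lemma haar_Rintegral (g : G) (h : borel G -> R) :
  mu.-integrable setT (EFin \o h) ->
  Rintegral mu setT (fun y => h (g * y)%g) = Rintegral mu setT h.
Proof.
move=> hi; have mg := mulgl_measurable g.
have muE A : measurable A ->
    pushforward mu (fun y : borel G => (g * y)%g : borel G) A = mu A.
  move=> mA; rewrite /pushforward -[RHS](proj1 (mu_haar g^-1%g mA)).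
  congr (mu _); apply/seteqP; split => y /=.
    by move=> gyA; exists (g * y)%g => //; rewrite mulKg.
  by move=> [z zA <-]; rewrite mulVKg.
have mh := measurable_int mu hi.
have hgi : mu.-integrable setT (EFin \o (fun y => h (g * y)%g)).
  apply/integrableP; split; first exact: (measurableT_comp mh mg).
  rewrite -[ltLHS](@ge0_integral_pushforward _ _ _ _ R _ mg mu setT
    (fun y => `|(h y)%:E|%E)) //; last exact: measurableT_comp.
  rewrite (eq_measure_integral mu); first by case/integrableP : hi.
  by move=> A mA _; exact: muE.
rewrite /Rintegral; congr fine.
rewrite -[LHS](@integral_pushforward _ _ _ _ R _ mg mu setT (EFin \o h)) //.
by apply: eq_measure_integral => A mA _; exact: muE.
Qed.

Section Rep.
Variables (d : nat) (p : G -> 'M[C]_d).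
Hypothesis prep : unitary_rep p.

Lemma rep_entry_continuous i j : continuous (fun y => p y i j : C^o).
Proof.
move=> y; have := @rep_continuous _ _ _ _ prep (delta_mx j 0) y.
have -> : (fun y => p y i j : C^o) =
    (fun M : 'cV[C^o]_d => M i 0) \o (fun y => p y *m delta_mx j 0).
  by apply/funext => z /=; rewrite -colE mxE.
move=> h; apply: (continuous_comp h); exact: (@coord_continuous C d 1 i 0).
Qed.

Lemma rep_entry_norm i j y : normc (p y i j) <= 1.
Proof.
apply: opbound_entry => //; apply: opbound_unitary; exact: rep_unitary.
Qed.

Lemma rep_Re_measurable i j :
  measurable_fun setT ((fun y => Re (p y i j)) : borel G -> R).
Proof.
apply: continuous_borel_measurable => y.
exact: (continuous_comp (@rep_entry_continuous i j y) (@Re_continuous _)).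
Qed.

Lemma rep_Im_measurable i j :
  measurable_fun setT ((fun y => Im (p y i j)) : borel G -> R).
Proof.
apply: continuous_borel_measurable => y.
exact: (continuous_comp (@rep_entry_continuous i j y) (@Im_continuous _)).
Qed.

Lemma rep_entry_mul_integrable (u : borel G -> R) i j :
  mu.-integrable setT (EFin \o u) ->
  Cintegrable mu (fun y => (u y)%:C%C * p y i j).
Proof.
move=> ui; split.
  have := integrable_bounded_mul ui (rep_Re_measurable i j)
    (fun y => le_trans (normRe_le _) (rep_entry_norm i j y)).
  by apply: eq_integrable => // y _ /=; rewrite ReM /= mul0r subr0.
have := integrable_bounded_mul ui (rep_Im_measurable i j)
  (fun y => le_trans (normIm_le _) (rep_entry_norm i j y)).
by apply: eq_integrable => // y _ /=; rewrite ImM /= mul0r addr0.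
Qed.

Lemma integrable_cst1 : mu.-integrable setT (EFin \o (fun _ : borel G => 1 : R)).
Proof. exact: finite_measure_integrable_cst. Qed.

Lemma rep_entry_integrable i j : Cintegrable mu (fun y => p y i j).
Proof.
have := rep_entry_mul_integrable i j integrable_cst1.
by congr Cintegrable; apply/funext => y; rewrite mul1r.
Qed.

Lemma haar_Cintegral (g : G) (h : borel G -> C) : Cintegrable mu h ->
  Cintegral mu (fun y => h (g * y)%g) = Cintegral mu h.
Proof.
by move=> [/(haar_Rintegral g) h1 /(haar_Rintegral g) h2]; rewrite /Cintegral h1 h2.
Qed.

Definition mean_mx : 'M[C]_d := \matrix_(i, j) Cintegral mu (fun y => p y i j).

Lemma rep_mean_mx x : p x *m mean_mx = mean_mx.
Proof.
apply/matrixP => i j; rewrite !mxE.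
rewrite -(haar_Cintegral x (rep_entry_integrable i j)).
under [RHS]eq_Cintegral do rewrite (rep_mul prep) mxE.
rewrite Cintegral_sum => [|k]; last by apply: CintegrableZ; exact: rep_entry_integrable.
by apply: eq_bigr => k _; rewrite mxE CintegralZ //; exact: rep_entry_integrable.
Qed.

(** By invariance the columns of the mean are fixed by [p]. A nonzero fixed
    vector spans an invariant line, hence the whole space, so that [p] would be
    the trivial representation of dimension 1. *)
Lemma mean_mx_eq0 : irreducible_rep p -> (exists x, p x != 1%:M) \/ d != 1%N ->
  mean_mx = 0.
Proof.
move=> [d0 pirr] nontriv; apply/matrixP => i j; rewrite [RHS]mxE.
pose v := col j mean_mx.
have pv x : p x *m v = v by rewrite /v colE mulmxA rep_mean_mx.
case: (pirr <[v]>%VS).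
- move=> x w /vlineP[k ->]; rewrite -scalemxAr pv.
  by apply/vlineP; exists k.
- move=> v0; have : v \in <[v]>%VS by exact: memv_line.
  rewrite v0 memv0 => /eqP/matrixP/(_ i 0); by rewrite !mxE.
move=> vfull; exfalso.
have d1 : d = 1%N.
  have : (\dim <[v]>%VS <= 1)%N by rewrite dim_vline leq_b1.
  rewrite vfull dimvf /dim /= muln1 => d1; apply/eqP; by rewrite eqn_leq d1.
case: nontriv => [[x /eqP]|]; last by rewrite d1.
apply; apply/matrixP => a b.
have : delta_mx b 0 \in <[v]>%VS by rewrite vfull memvf.
move=> /vlineP[k bE].
have : p x *m delta_mx b 0 = delta_mx b 0 :> 'cV[C]_d by rewrite bE -scalemxAr pv.
by rewrite -colE => /matrixP/(_ a 0); rewrite !mxE eqxx andbT.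
Qed.

End Rep.
End GroupIntegrals.

(** * The operator norm of the Fourier coefficients *)

Section FourierBound.
Context (R : realType) (G : topologicalGroupType).
Local Notation C := R[i].
Local Notation Re := (@complex.Re R).
Local Notation Im := (@complex.Im R).
Variables (mu : probability (borel G) R).
Hypothesis mu_haar : haar_probability mu.
Variable f : borel G -> C.
Hypothesis f_L1 : L1 mu f.
Hypothesis f_Re : {ae mu, forall y, Re (f y) <= 1}.

Lemma L1_Cintegrable : Cintegrable mu f.
Proof.
have [mRe mIm fin] := f_L1.
have mnorm : measurable_fun setT (fun y => normc (f y)).
  have -> : (fun y => normc (f y)) =
      (fun y => Num.sqrt (Re (f y) ^+ 2 + Im (f y) ^+ 2)).
    by apply/funext => y; case: (f y).
  apply: (measurableT_comp (continuous_measurable_fun (@sqrt_continuous R))).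
  by apply: measurable_funD; exact: measurable_funX.
have ni : mu.-integrable setT (EFin \o (fun y => normc (f y))).
  apply/integrableP; split; first exact/measurable_EFinP.
  apply: le_lt_trans fin; rewrite le_eqVlt; apply/predU1l.
  by apply: eq_integral => y _ /=; rewrite ger0_norm ?normc_ge0.
split; apply: le_integrable ni => //; try exact/measurable_EFinP.
  by move=> y _ /=; rewrite lee_fin (ger0_norm (normc_ge0 _)) normRe_le.
by move=> y _ /=; rewrite lee_fin (ger0_norm (normc_ge0 _)) normIm_le.
Qed.

Variables (d : nat) (p : G -> 'M[C]_d).
Hypothesis prep : unitary_rep p.
Hypothesis pmean : mean_mx mu p = 0.

(** This is the Fourier coefficient of [2 Re f] at [p]. *)
Definition fourier_sym : 'M[C]_d :=
  fourier mu f p + map_mx Num.conj (fourier mu f (contragredient p)).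

Let kern (y : borel G) : 'M[C]_d :=
  (2 * (1 - Re (f y)))%:C%C *: - (p y)^t*.

Let u_int : mu.-integrable setT (EFin \o (fun y => Re (f y))) := proj1 L1_Cintegrable.
Let v_int : mu.-integrable setT (EFin \o (fun y => Im (f y))) := proj2 L1_Cintegrable.
Let one_int := integrable_cst1 mu.

Lemma adj_mul_integrable (u : borel G -> R) i j :
  mu.-integrable setT (EFin \o u) ->
  Cintegrable mu (fun y => (u y)%:C%C * ((p y)^t*) i j).
Proof.
move=> ui; have := Cintegrable_conj (rep_entry_mul_integrable prep j i ui).
by congr Cintegrable; apply/funext => y; rewrite !mxE rmorphM /= conj_rC.
Qed.

(** The mean of [p] being zero, [2 Re f] may be replaced by
    [2 (Re f - 1)], which has a constant sign. *)
Lemma fourier_sym_entry i j :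
  fourier_sym i j = Cintegral mu (fun y => kern y i j).
Proof.
rewrite /fourier_sym !mxE.
set q := fun y => ((p y)^t*) i j.
have fq : Cintegrable mu (fun y => f y * q y).
  have := CintegrableD (adj_mul_integrable i j u_int)
    (CintegrableZ 'i%C (adj_mul_integrable i j v_int)).
  congr Cintegrable; apply/funext => y; rewrite [in RHS](complexE (f y)).
  by rewrite mulrDl mulrA.
have fqc : Cintegrable mu (fun y => f y * (q y)^*).
  have := CintegrableD (rep_entry_mul_integrable prep j i u_int)
    (CintegrableZ 'i%C (rep_entry_mul_integrable prep j i v_int)).
  congr Cintegrable; apply/funext => y; rewrite [in RHS](complexE (f y)).
  by rewrite mulrDl mulrA /q !mxE conjCK.
have -> : (fun y => f y * (contragredient p y)^t* i j) = (fun y => f y * (q y)^*).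
  by apply/funext => y; rewrite /q !mxE.
rewrite -(Cintegral_conj fqc) -(CintegralD fq (Cintegrable_conj fqc)).
have q0 : Cintegral mu q = 0.
  have -> : q = fun y => (p y j i)^* by apply/funext => y; rewrite /q !mxE.
  rewrite Cintegral_conj; last exact: rep_entry_integrable.
  by move/matrixP : pmean => /(_ j i); rewrite !mxE => ->; rewrite conjC0.
have qi : Cintegrable mu q.
  have := adj_mul_integrable i j one_int.
  by congr Cintegrable; apply/funext => y; rewrite mul1r.
rewrite -[LHS]addr0 -(mulr0 (- 2)) -q0 -(CintegralZ _ qi) -CintegralD; last 2 first.
- by apply: CintegrableD => //; exact: Cintegrable_conj.
- exact: CintegrableZ.
apply: eq_Cintegral => y; rewrite /kern.
have -> : ((2 * (1 - Re (f y)))%:C%C *: - (p y)^t*) i j =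
    - ((2 * (1 - Re (f y)))%:C%C * q y) by rewrite /q !mxE mulrN.
rewrite [X in _ + X + _]rmorphM /= conjCK -mulrDl.
have -> : f y + (f y)^* = (2 * Re (f y))%:C%C.
  by rewrite -[_ ^*]/((f y)^*%C) addcJ rmorphM /= rmorph_nat.
rewrite -mulrDl -mulNr; congr (_ * _).
by rewrite !(rmorphM, rmorphB) /= !rmorph_nat rmorph1; ring.
Qed.

(** The matrix is the integral of the unitary matrices [- p(y)^H] against
    the nonnegative density [2 (1 - Re f)], whose total mass is the claimed
    bound. *)
Lemma opbound_fourier_sym : opbound (2 * (1 - Re (Cintegral mu f))) fourier_sym.
Proof.
have ki i j : Cintegrable mu (fun y => kern y i j).
  have := adj_mul_integrable i j (RintegrableZ (- 2) (RintegrableB one_int u_int)).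
  congr Cintegrable; apply/funext => y; rewrite /kern !mxE mulNr rmorphN /=.
  by rewrite mulrN mulNr.
move=> w v.
have -> : fourier_sym = \matrix_(i, j) Cintegral mu (fun y => kern y i j).
  by apply/matrixP => i j; rewrite fourier_sym_entry mxE.
have [-> [gi _]] := Cintegral_form w v ki.
rewrite /=; set S := (sqn w + sqn v) / 2.
have Si := RintegrableZ (2 * S) (RintegrableB one_int u_int).
have -> : 2 * (1 - Rintegral mu setT (fun x => Re (f x))) * S =
    Rintegral mu setT (fun y => 2 * S * (1 - Re (f y))).
  rewrite RintegralZl //; last exact: RintegrableB.
  rewrite RintegralB // Rintegral_cst //.
  have -> : fine (mu [set: borel G]) = 1 by rewrite (@probability_setT _ _ _ mu).
  ring.
apply: ae_le_Rintegral => //; apply: filterS f_Re => y fy.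
have -> : (w^t* *m kern y *m v) 0 0 =
   (2 * (1 - Re (f y)))%:C%C * (w^t* *m (- (p y)^t*) *m v) 0 0.
  by rewrite /kern -scalemxAr -scalemxAl mxE.
rewrite ReM /= mul0r subr0 [leRHS]mulrAC; apply: ler_wpM2l.
  by rewrite mulr_ge0 // subr_ge0.
have pu : - (p y)^t* \is unitarymx.
  apply/unitarymxP; rewrite linearN /= map_mxN mulmxN mulNmx opprK.
  by apply/unitarymxP/unitary_adj; exact: rep_unitary.
by have := opbound_unitary pu w v; rewrite mul1r.
Qed.

End FourierBound.

(** * Summation over the dual *)

Section Dual.
Context (R : realType) (G : topologicalGroupType).
Local Notation C := R[i].

Lemma trivial_equiv a b (q : G -> 'M[C]_a) (q' : G -> 'M[C]_b) :
  a = 1%N -> b = 1%N -> (forall x, q x = 1%:M) -> (forall x, q' x = 1%:M) ->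
  unitarily_equivalent q q'.
Proof.
move=> ea eb; move: q q'; rewrite ea eb => q q' q1 q1'.
exists 1%:M; split; rewrite ?trmx1 ?map_mx1 ?mulmx1 // => x.
by rewrite q1 q1'.
Qed.

(** The class of index [n >= 1] differs from the trivial one of index 0. *)
Lemma dual_mean_mx (mu : probability (borel G) R) (mu_haar : haar_probability mu)
  (L : set nat) (d : nat -> nat) (p : forall n, G -> 'M[C]_(d n))
  (p_dual : unitary_dual L p) n : L n -> mean_mx mu (p n) = 0.
Proof.
move=> Ln; have Ln' : (0%N |` L) n by right.
have n0 : n != 0%N.
  by case: (dual_index p_dual) Ln => [|[n1]] -> /=; case: (n).
have [prep pirr] := dual_irreducible p_dual Ln'.
apply: (mean_mx_eq0 mu_haar prep pirr).
have [dn|] := eqVneq (d n) 1%N; last by right.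
left; apply: contrapT => triv.
have p1 x : p n x = 1%:M.
  by apply/eqP; apply: contrapT => /negP px; apply: triv; exists x.
have [d0 p0] := dual_trivial p_dual.
have := dual_distinct p_dual (or_introl (erefl 0%N) : (0%N |` L) 0%N) Ln'
  (trivial_equiv d0 dn p0 p1).
by move/esym/eqP; rewrite (negPf n0).
Qed.

Lemma esum_le_scale (L : set nat) (a b : nat -> R) (c t : R) : 0 <= c ->
  (forall n, L n -> a n <= c * b n) ->
  (\esum_(n in L) (b n)%:E <= t%:E)%E ->
  (\esum_(n in L) (a n)%:E <= (c * t)%:E)%E.
Proof.
move=> c0 ab bt; apply: ub_ereal_sup => _ [X [finX XL] <-].
have : (\sum_(n \in X) (b n)%:E <= t%:E)%E.
  by apply: le_trans bt; apply: esum_ge; exists X.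
rewrite !fsbig_finite //= !sumEFin !lee_fin => bX.
apply: le_trans (ler_wpM2l c0 bX); rewrite mulr_sumr.
rewrite big_seq [leRHS]big_seq; apply: ler_sum => n.
by rewrite in_fset_set // inE => /XL; exact: ab.
Qed.

Lemma powR_root (x t : R) k : (0 < k)%N -> 0 <= x -> 0 <= t -> x <= t ^+ k ->
  x `^ (k%:R^-1) <= t.
Proof.
move=> k0 x0 t0 xt.
have -> : t = (t ^+ k) `^ (k%:R^-1).
  by rewrite -powR_mulrn // -powRrM divff ?powRr1 // pnatr_eq0 -lt0n.
by rewrite ge0_ler_powR ?invr_ge0 // nnegrE ?exprn_ge0.
Qed.
End Dual.

Theorem theorem1 (R : realType) (G : topologicalGroupType)
  (G_second_countable : @second_countable G)
  (G_compact : compact [set: G])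
  (G_hausdorff : hausdorff_space G)
  (mu : probability (borel G) R) (mu_haar : haar_probability mu)
  (L : set nat) (d : nat -> nat) (p : forall n, G -> 'M[R[i]]_(d n))
  (p_dual : unitary_dual L p)
  (f : borel G -> R[i]) (f_L1 : L1 mu f)
  (f_Re : {ae mu, forall y, complex.Re (f y) <= 1})
  (r : forall n, 'M[R[i]]_(d n))
  (N : forall n, 'M[R[i]]_(d n) -> R)
  (N_norm : forall n, L n -> unitarily_invariant_norm (@N n))
  (phi : forall n, 'rV[R[i]]_(d n * d n) -> R)
  (phi_gauge : forall n, L n -> symmetric_gauge (@phi n))
  (H : forall n, {group 'S_(d n)}) (chi : forall n, 'S_(d n) -> R[i])
  (chi_char : forall n, L n -> degree1_character (H n) (@chi n))
  (o : triple_product) (x : G) :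
  let f0 := Cintegral mu f in
  let A n := dot3 o
    (fourier mu f (@p n) +
       map_mx Num.conj (fourier mu f (contragredient (@p n))))
    (p n x) (r n) in
  let S1 := ((complex.Re f0)%:E + \esum_(n in L) (N n (A n))%:E)%E in
  let S2 := ((complex.Re f0)%:E + \esum_(n in L) (phi n (mxvec (A n)))%:E)%E in
  let S3 := ((complex.Re f0)%:E +
    \esum_(n in L)
      (normc (gen_matrix_fun (H n) (@chi n) (A n)) `^ ((d n)%:R^-1))%:E)%E in
  (0 <= f0 < 1 ->
    [/\ (\esum_(n in L) (N n (r n))%:E <= (1 / 2)%:E)%E -> (S1 <= 1)%E,
        (\esum_(n in L) ((d n)%:R ^+ 2 * phi n (mxvec (r n)))%:E
           <= (1 / 2)%:E)%E -> (S2 <= 1)%E &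
        (\esum_(n in L) (N n (r n) / N n (@E11 R (d n)))%:E
           <= (1 / 2)%:E)%E -> (S3 <= 1)%E])
  /\
  (f0 = 1 -> [/\ S1 = 1%E, S2 = 1%E & S3 = 1%E]).
Proof.
move=> f0 A S1 S2 S3.
(* c bounds the operator norm of the symmetrized Fourier coefficients *)
pose c : R := 2 * (1 - complex.Re f0).
have Ln0 n : L n -> (0%N |` L) n by right.
have rep n (Ln : L n) : unitary_rep (p n).
  by have [] := dual_irreducible p_dual (Ln0 n Ln).
have d_gt0 n : L n -> (0 < d n)%N.
  by move=> /Ln0 /(dual_irreducible p_dual)[_ []].
have Bc n : L n -> opbound c (fourier_sym mu f (p n)).
  move=> Ln; apply: opbound_fourier_sym => //; first exact: rep.
  exact: (dual_mean_mx mu_haar p_dual).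
have pu n : L n -> p n x \is unitarymx.
  by move=> Ln; apply: rep_unitary; exact: rep.
have NA n : 0 <= c -> L n -> N n (A n) <= c * N n (r n).
  move=> c0 Ln; exact: (uinorm_dot3 (N_norm n Ln) o _ c0 (Bc n Ln) (pu n Ln)).
have phiA n : 0 <= c -> L n ->
    phi n (mxvec (A n)) <= c * ((d n)%:R ^+ 2 * phi n (mxvec (r n))).
  move=> c0 Ln.
  exact: (gauge_dot3 (phi_gauge n Ln) o _ (d_gt0 n Ln) c0 (Bc n Ln) (pu n Ln)).
have chiA n : 0 <= c -> L n ->
    normc (gen_matrix_fun (H n) (@chi n) (A n)) `^ ((d n)%:R^-1) <=
    c * (N n (r n) / N n (@E11 R (d n))).
  move=> c0 Ln; have [NN _] := N_norm n Ln.
  have E0 := uinorm_E11_gt0 (N_norm n Ln) (d_gt0 n Ln).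
  have t0 : 0 <= N n (A n) / N n (@E11 R (d n)).
    by rewrite divr_ge0 ?(is_norm_ge0 NN) // ltW.
  apply: (@le_trans _ _ (N n (A n) / N n (@E11 R (d n)))); last first.
    by rewrite mulrA ler_pM2r ?invr_gt0 // NA.
  apply: powR_root; rewrite ?normc_ge0 ?d_gt0 //.
  apply: (gen_matrix_fun_le (chi_char n Ln)) => //.
  exact: (uinorm_opbound (N_norm n Ln) _ (d_gt0 n Ln)).
have one : complex.Re f0 + c * (1 / 2) = 1.
  by rewrite /c; move: (complex.Re f0) => t; field.
split.
  move=> /andP[_]; rewrite ltcE => /andP[_ /=] f01.
  have c0 : 0 <= c by rewrite mulr_ge0 // subr_ge0 ltW.
  by split=> sm; rewrite -[leRHS]/(1%:E) -one EFinD leeD2l //;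
    apply: esum_le_scale sm => // n Ln; [exact: NA|exact: phiA|exact: chiA].
move=> f01; have c0 : c = 0 by rewrite /c f01 /= subrr mulr0.
have cge : 0 <= c by rewrite c0.
have S_eq (a b : nat -> R) : (forall n, L n -> 0 <= a n) ->
    (forall n, L n -> a n <= c * b n) ->
    ((complex.Re f0)%:E + \esum_(n in L) (a n)%:E = 1)%E.
  move=> a0 ab; rewrite f01 esum1 ?adde0 // => n Ln; congr (_%:E).
  by apply/eqP; rewrite eq_le a0 // andbT (le_trans (ab n Ln)) // c0 mul0r.
split.
- apply: (S_eq _ (fun n => N n (r n))) => n Ln; last exact: NA.
  by have [NN _] := N_norm n Ln; exact: (is_norm_ge0 NN).
- apply: (S_eq _ (fun n => (d n)%:R ^+ 2 * phi n (mxvec (r n)))) => n Ln;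
    last exact: phiA.
  by have [NN _ _] := phi_gauge n Ln; exact: (is_norm_ge0 NN).
apply: (S_eq _ (fun n => N n (r n) / N n (@E11 R (d n)))) => n Ln;
  last exact: chiA.
exact: powR_ge0.
Qed.
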